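(* Let $S$ be a nonnegative symmetric linear relation in a complex Hilbert space $\mathcal H$, with Friedrichs extension $S_{\rm F}$ and Kreĭn extension $S_{\rm K}$, such that $$\dim\operatorname{ran}\big((S_{\rm K}+I)^{-1}-(S_{\rm F}+I)^{-1}\big)=1.$$ Suppose that $\widetilde S_1$ and $\widetilde S_2$ are two different non-extremal nonnegative selfadjoint extensions of $S$. Then the arithmetic--harmonic mean $ah(\widetilde S_1,\widetilde S_2)$ is a singleton. Moreover, if the numbers $\widetilde z_1,\widetilde z_2\in[-1,1]$ correspond to $\widetilde S_1,\widetilde S_2$ in the resolvent formula $$(\widetilde S_j+I)^{-1}=\tfrac12\big((S_{\rm K}+I)^{-1}+(S_{\rm F}+I)^{-1}\big)+\tfrac{\widetilde z_j}{2}\big((S_{\rm K}+I)^{-1}-(S_{\rm F}+I)^{-1}\big),\quad j=1,2,$$ then $$\big(ah(\widetilde S_1,\widetilde S_2)+I\big)^{-1}=\tfrac12\big((S_{\rm K}+I)^{-1}+(S_{\rm F}+I)^{-1}\big)+\tfrac{\widetilde w}{2}\big((S_{\rm K}+I)^{-1}-(S_{\rm F}+I)^{-1}\big),$$ where $$\widetilde w=\frac{\sqrt{(1+\widetilde z_1)(1+\widetilde z_2)}-\sqrt{(1-\widetilde z_1)(1-\widetilde z_2)}}{\sqrt{(1+\widetilde z_1)(1+\widetilde z_2)}+\sqrt{(1-\widetilde z_1)(1-\widetilde z_2)}}.$$ In particular, for a nonnegative selfadjoint extension $\widetilde S$ of $S$: $ah(S_{\rm F},\widetilde S)=S_{\rm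 F}$ when $\widetilde S\ne S_{\rm K}$, and $ah(S_{\rm K},\widetilde S)=S_{\rm K}$ when $\widetilde S\neq S_{\rm F}$.
   Context: A linear relation (l.r.) in $\mathcal H$ is a closed linear subspace $A=\{\{f,f'\}\}$ of $\mathcal H\oplus\mathcal H$; $\operatorname{mul}A=\{f':\{0,f'\}\in A\}$; $A^{-1}=\{\{f',f\}:\{f,f'\}\in A\}$; $\lambda A=\{\{f,\lambda f'\}\}$. $A$ is symmetric if $A\subseteq A^*$, selfadjoint if $A=A^*$, where $A^*:=\{\{g,g'\}:(f',g)=(f,g')\ \forall\{f,f'\}\in A\}$; nonnegative if $(f',f)\ge0$ for all $\{f,f'\}\in A$. A nonnegative selfadjoint l.r. decomposes as $A=\mathrm{Graph}(A_o)\oplus(\{0\}\oplus\operatorname{mul}A)$ with $A_o$ a nonnegative selfadjoint operator in $\mathcal H\ominus\operatorname{mul}A$. The closed form of $A$ is $A[\varphi]=\|A_o^{1/2}\varphi\|^2$, $\varphi\in\mathcal D[A]=\operatorname{dom}A_o^{1/2}$; this gives a bijection between nonnegative selfadjoint l.r. and closed nonnegative (not necessarily densely defined) forms. The form sum $A\dot+B$ is the nonnegative selfadjoint l.r. associated with the closed form $A[\varphi]+B[\varphi]$, $\varphi\in\mathcal D[A]\cap\mathcal D[B]$. The harmonic mean is $h(A,B):=\big(\tfrac12(A^{-1}\dot+B^{-1})\big)^{-1}$. Arithmetic--harmonic means: put $A_0=A$, $B_0=B$, $A_n=\tfrac12(A_{n-1}\dot+B_{n-1})$, $B_n=h(A_{n-1},B_{n-1})$,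 $n\ge1$. The limits $A_\infty,B_\infty$ of $\{A_n\},\{B_n\}$ in the strong resolvent sense (strong convergence of $(A_n+I)^{-1}$ to $(A_\infty+I)^{-1}$, similarly for $B_n$) exist, and $ah(A,B):=\langle A_\infty,B_\infty\rangle$ (ordered pair). ''$ah(A,B)$ is a singleton'' means $A_\infty=B_\infty$, and then $ah(A,B)$ also denotes this common relation; $ah(A,B)=L$ means $A_\infty=B_\infty=L$. For a nonnegative symmetric l.r. $S$, the Friedrichs extension $S_{\rm F}$ is the nonnegative selfadjoint l.r. associated with the closure of the form $\mathfrak s[f,g]=(f',g)$, $\{f,f'\},\{g,g'\}\in S$; the Kreĭn extension is $S_{\rm K}=((S^{-1})_{\rm F})^{-1}$. A nonnegative selfadjoint extension $\widetilde S$ of $S$ is called extremal if $\inf\{(f'-g',f-g):\{g,g'\}\in S\}=0$ for all $\{f,f'\}\in\widetilde S$. Under the dimension-one hypothesis, the only extremal extensions are $S_{\rm F}$ and $S_{\rm K}$, and by Kreĭn's theory every nonnegative selfadjoint extension $\widetilde S$ of $S$ satisfies the resolvent formula above with a unique $\widetilde z\in[-1,1]$. *)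

(* Defs.v *)
From mathcomp Require Export all_boot all_order all_algebra.
From mathcomp Require Export complex.
From mathcomp Require Export all_classical all_reals all_analysis.
Export Order.TTheory GRing.Theory Num.Theory.
Export numFieldNormedType.Exports.

Set Implicit Arguments.
Unset Strict Implicit.
Unset Printing Implicit Defensive.

Local Open Scope classical_set_scope.
Local Open Scope ring_scope.
Local Open Scope complex_scope.

(* A complex Hilbert space is a complete normed space H over R[i] together
   with an inner product dot (linear in its first argument) such that
   dot x x = `|x| ^+ 2; the last condition is a hypothesis of the theorem.
   A relation in H is a subset of H * H, the pair (f, f') standing for
   {f, f'}. Relations and vectors defined by a unique characterization are
   obtained with xget, whose default value is irrelevant. *)

Section LinearRelations.
Context {R : realType} {H : completeNormedModType R[i]}.
Implicit Types A B T : set (H * H).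

Definition linear_relation A : Prop :=
  [/\ A (0, 0),
      forall (a : R[i]) (p q : H * H), A p -> A q ->
        A (a *: p.1 + q.1, a *: p.2 + q.2)
    & closed A].

Definition mul_part A : set H := [set m | A (0, m)].
Definition inv_rel A : set (H * H) := [set p | A (p.2, p.1)].
Definition scale_rel (a : R[i]) A : set (H * H) :=
  [set (p.1, a *: p.2) | p in A].
Definition comp_rel A B : set (H * H) :=
  [set p | exists2 g, A (p.1, g) & B (g, p.2)].
Definition addI_rel A : set (H * H) := [set (p.1, p.2 + p.1) | p in A].

(* (A + I)^-1 as a map on H; for a nonnegative selfadjoint relation A, the
   relation inv_rel (addI_rel A) is the graph of an everywhere defined
   bounded operator. *)
Definition resolvent A (x : H) : H :=
  xget 0 [set y | inv_rel (addI_rel A) (x, y)].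

Definition has_dim (n : nat) (V : set H) : Prop :=
  exists e : 'I_n -> H,
    (forall a : 'I_n -> R[i], \sum_i a i *: e i = 0 -> forall i, a i = 0) /\
    V = range (fun a : 'I_n -> R[i] => \sum_i a i *: e i).

(* A quadratic form q is encoded by its graph: (f, c) belongs to q iff f is
   in the domain of q and q[f] = c. The sesquilinear form is determined by q
   through polarization. *)
Implicit Types q : set (H * R[i]).

Definition form_add (q1 q2 : set (H * R[i])) : set (H * R[i]) :=
  [set p | exists c1 c2, [/\ q1 (p.1, c1), q2 (p.1, c2) & p.2 = c1 + c2]].

(* f is in the domain of the closure of q iff there are f_n in the domain of
   q with f_n --> f and q[f_n - f_m] --> 0; its value at f is lim q[f_n].
   (R[i]^o is R[i] with its topology as a normed space over itself.) *)
Definition form_closure q : set (H * R[i]) :=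
  [set p | exists (f : nat -> H) (c : nat -> R[i]),
    [/\ forall n, q (f n, c n),
        f @ \oo --> p.1,
        forall e : R[i], 0 < e -> exists N : nat, forall n m : nat,
          (N <= n)%N -> (N <= m)%N ->
          exists2 d, q (f n - f m, d) & `|d| < e
      & (c : nat -> R[i]^o) @ \oo --> (p.2 : R[i]^o)]].

End LinearRelations.

Section HilbertSpace.
Context {R : realType} {H : completeNormedModType R[i]}.
Variable dot : {dot H for (@Num.conj R[i])}.
Implicit Types A B S T L : set (H * H).

Definition orth (V : set H) : set H :=
  [set x | forall v, V v -> dot x v = 0].

Definition adjoint A : set (H * H) :=
  [set g | forall f, A f -> dot f.2 g.1 = dot f.1 g.2].
Definition symmetric_rel A : Prop := A `<=` adjoint A.
Definition nonneg_rel A : Prop := forall f, A f -> 0 <= dot f.2 f.1.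

(* A is a nonnegative selfadjoint relation in the Hilbert space M, for M a
   closed subspace of H. *)
Definition nonneg_selfadjoint_in (M : set H) A : Prop :=
  [/\ linear_relation A, A = adjoint A `&` (M `*` M) & nonneg_rel A].
Definition nonneg_selfadjoint A : Prop := nonneg_selfadjoint_in setT A.

Definition sqrt_in (M : set H) A : set (H * H) :=
  xget set0 [set T | [/\ nonneg_selfadjoint_in M T,
                         mul_part T = [set 0] & comp_rel T T = A]].

(* The operator part A_o, acting in the orthogonal complement of mul A. *)
Definition op_part A : set (H * H) :=
  A `&` (orth (mul_part A) `*` orth (mul_part A)).

(* A[f] = || A_o^{1/2} f ||^2 with domain dom A_o^{1/2} *)
Definition closed_form A : set (H * R[i]) :=
  [set p | exists2 u, sqrt_in (orth (mul_part A)) (op_part A) (p.1, u)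
                    & p.2 = `|u| ^+ 2].

Definition rel_of_form (q : set (H * R[i])) : set (H * H) :=
  xget set0 [set A | nonneg_selfadjoint A /\ closed_form A = q].

Definition form_sum A B : set (H * H) :=
  rel_of_form (form_add (closed_form A) (closed_form B)).

Definition arith_mean A B : set (H * H) := scale_rel 2^-1 (form_sum A B).
Definition harm_mean A B : set (H * H) :=
  inv_rel (scale_rel 2^-1 (form_sum (inv_rel A) (inv_rel B))).

Definition ah_seq A B (n : nat) : set (H * H) * set (H * H) :=
  iter n (fun p => (arith_mean p.1 p.2, harm_mean p.1 p.2)) (A, B).

Definition strong_resolvent_limit (A_ : nat -> set (H * H)) L : Prop :=
  nonneg_selfadjoint L /\
  forall x, (fun n => resolvent (A_ n) x) @ \oo --> resolvent L x.

(* is_ah A B L : the limits A_oo and B_oo exist and ah(A, B) = <A_oo, B_oo>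
   is the ordered pair L. *)
Definition is_ah A B (L : set (H * H) * set (H * H)) : Prop :=
  strong_resolvent_limit (fun n => (ah_seq A B n).1) L.1 /\
  strong_resolvent_limit (fun n => (ah_seq A B n).2) L.2.

Definition form_of_rel S : set (H * R[i]) :=
  [set (f.1, dot f.2 f.1) | f in S].

Definition friedrichs S : set (H * H) :=
  rel_of_form (form_closure (form_of_rel S)).
Definition krein S : set (H * H) := inv_rel (friedrichs (inv_rel S)).

Definition nonneg_selfadjoint_ext S T : Prop :=
  nonneg_selfadjoint T /\ S `<=` T.

(* The numbers dot (f' - g') (f - g) are real and nonnegative, since
   T is a nonnegative relation containing S. *)
Definition extremal S T : Prop :=
  nonneg_selfadjoint_ext S T /\
  forall f, T f -> inf [set complex.Re (dot (f.2 - g.2) (f.1 - g.1)) | g in S] = 0.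

Definition resolvent_formula S T (z : R) : Prop :=
  forall x, resolvent T x =
    2^-1 *: (resolvent (krein S) x + resolvent (friedrichs S) x) +
    (z / 2)%:C *: (resolvent (krein S) x - resolvent (friedrichs S) x).

End HilbertSpace.

(* Main.v *)
(** Write X for the resolvent (A + I)^-1. When S_K and S_F differ by a rank
    one resolvent, (S_K + I)^-1 = X_F + (., e) e, and the resolvents of the
    nonnegative selfadjoint extensions of S are the X_t = X_F + t (., e) e,
    0 <= t <= 1. The vector e is orthogonal to ran (S + I), hence is not in the
    form domain of S_F, so the closed form of the extension A_t with resolvent
    X_t splits: A_t[f + a e] + |f + a e|^2 = S_F[f] + |f|^2 + |a|^2 / t.
    Therefore the arithmetic mean of A_s and A_t is A_r for r the harmonic mean
    of s and t, and, passing to inverses (which replaces t by 1 - t), 1 - r is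
    the harmonic mean of 1 - s and 1 - t for the harmonic mean of A_s and A_t.
    This scalar iteration contracts |s - t| as soon as |s - t| < 1, and it
    preserves the ratio s t : (1 - s) (1 - t), which identifies the limit. *)
Require Import Defs.
From mathcomp Require Import ring lra.

Set Implicit Arguments.
Unset Strict Implicit.
Unset Printing Implicit Defensive.

Local Open Scope classical_set_scope.
Local Open Scope ring_scope.
Local Open Scope complex_scope.

(** The notions of the statement are chosen by [xget], so each must be pinned down before anything
    can be computed. The device is the bounded map X = (A + I)^-1: nonnegative selfadjoint A
    correspond to symmetric X with 0 <= X <= I, and A^-1 corresponds to I - X. Multivalued parts
    then cause no case distinction, and facts about S_K are facts about S_F for the inverse of S.
    The closed form becomes [res_form], a limit of (X h, h) along form-Cauchy sequences. This
    expression is additive in X_F + t (., e) e, which is where the splitting comes from: t |(h,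
    e)|^2 turns into |a|^2 / t for a = t (h, e). A form sum is computed by exhibiting a relation,
    which its form determines through the duality (X h, h) = sup (2 Re (f, h) - A[f] - |f|^2). The
    same duality traps the resolvent of every extension between X_F and that of S_K. The condition
    |s - t| < 1 says that {s, t} is not {0, 1}: the parameters (0, 1) are a fixed point of the
    iteration, with two different limits. *)

Definition inner_norm (R : realType) (H : completeNormedModType R[i])
    (dot : {dot H for (@Num.conj R[i])}) : Prop :=
  forall x : H, dot x x = `|x| ^+ 2.
Arguments inner_norm {R H} dot.
(* A class, so that lemmas recover dot from the context. *)
Existing Class inner_norm.

(** * Real inner product geometry and convergence in H *)

Section RealInnerProduct.
Context {R : realType} {H : completeNormedModType R[i]}.
Context {dot : {dot H for (@Num.conj R[i])}} {dot_norm : inner_norm dot}.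
Implicit Types (x y z u v : H) (a b : R).

(* H is treated as a real inner product space: the complex form is recovered
   from its real part by dotE. *)
Definition rdot x y : R := complex.Re (dot x y).
Definition rnorm x : R := complex.Re `|x|.

Lemma dot_conj x y : dot x y = (dot y x)^*.
Proof. by rewrite (hermC dot) expr0 mul1r. Qed.

Lemma rdotC x y : rdot x y = rdot y x.
Proof. by rewrite /rdot dot_conj; case: (dot y x). Qed.

Lemma rdotDl x y z : rdot (x + y) z = rdot x z + rdot y z.
Proof. by rewrite /rdot linearDl raddfD. Qed.

Lemma rdotZl a x z : rdot (a%:C *: x) z = a * rdot x z.
Proof.
rewrite /rdot linearZl_LR /=; case: (dot x z) => u v /=.
by rewrite mul0r subr0.
Qed.

Lemma rdotNl x z : rdot (- x) z = - rdot x z.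
Proof. by rewrite /rdot linearNl raddfN. Qed.

Lemma rdotDr x y z : rdot z (x + y) = rdot z x + rdot z y.
Proof. by rewrite rdotC rdotDl !(rdotC z). Qed.
Lemma rdotZr a x z : rdot z (a%:C *: x) = a * rdot z x.
Proof. by rewrite rdotC rdotZl !(rdotC z). Qed.
Lemma rdotNr x z : rdot z (- x) = - rdot z x.
Proof. by rewrite rdotC rdotNl !(rdotC z). Qed.

Lemma rdot0l z : rdot 0 z = 0.
Proof. by rewrite /rdot linear0l. Qed.
Lemma rdot0r z : rdot z 0 = 0.
Proof. by rewrite rdotC rdot0l. Qed.

Definition rdotE := (rdotDl, rdotDr, rdotNl, rdotNr, rdotZl, rdotZr).

Lemma rdotil x y : rdot ('i *: x) y = - rdot x ('i *: y).
Proof.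
rewrite /rdot linearZl_LR linearZr /=; case: (dot x y) => u v /=.
by rewrite !mul0r !mul1r sub0r mulN1r add0r opprK.
Qed.

Lemma dotE x y : dot x y = (rdot x y +i* rdot x ('i *: y)).
Proof.
rewrite /rdot linearZr /=; case: (dot x y) => u v /=.
by rewrite !mul0r mulN1r opprK add0r.
Qed.

Lemma scaler_i_i x : 'i *: ('i *: x) = - x.
Proof.
by rewrite scalerA -expr2 sqr_i scaleN1r.
Qed.

Lemma rdotii x y : rdot ('i *: x) ('i *: y) = rdot x y.
Proof. by rewrite rdotil scaler_i_i rdotNr opprK. Qed.

Lemma complex_scale (c : R[i]) x :
  c *: x = (complex.Re c)%:C *: x + (complex.Im c)%:C *: ('i *: x).
Proof.
rewrite {1}(complexE c) scalerDl; congr (_ + _).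
by rewrite scalerA mulrC.
Qed.

Lemma rnormE x : `|x| = (rnorm x)%:C.
Proof.
rewrite /rnorm; have /ger0_Im := normr_ge0 x.
by case: (`|x|) => u v /= ->.
Qed.

Lemma rnorm_ge0 x : 0 <= rnorm x.
Proof. by rewrite -ler0c -rnormE. Qed.

Lemma rnormD x y : rnorm (x + y) <= rnorm x + rnorm y.
Proof.
have := ler_normD x y; rewrite !rnormE -raddfD /= lecR //.
Qed.

Lemma rnormN x : rnorm (- x) = rnorm x.
Proof. by rewrite /rnorm normrN. Qed.

Lemma rnorm_sub x y : rnorm (x - y) = rnorm (y - x).
Proof. by rewrite -rnormN opprB. Qed.

Lemma rnorm_eq0 x : rnorm x = 0 -> x = 0.
Proof. by move=> h; apply/normr0_eq0; rewrite rnormE h. Qed.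

Lemma rnorm0 : rnorm 0 = 0.
Proof. by rewrite /rnorm normr0. Qed.

Lemma rnorm_sqr x : rnorm x ^+ 2 = rdot x x.
Proof.
by apply: complexI; rewrite rmorphXn /= -rnormE -dot_norm /rdot dot_norm rnormE
  -rmorphXn.
Qed.

Lemma dot_rnorm x : dot x x = (rdot x x)%:C.
Proof. by rewrite -rnorm_sqr rmorphXn /= -rnormE. Qed.

Lemma rnorm_triangle x y z : rnorm (x - z) <= rnorm (x - y) + rnorm (y - z).
Proof.
have -> : x - z = (x - y) + (y - z) by rewrite addrA subrK.
exact: rnormD.
Qed.

Lemma rnormZ a x : rnorm (a%:C *: x) = `|a| * rnorm x.
Proof.
apply: complexI.
by rewrite -rnormE normrZ rnormE rmorphM normc_def /= expr0n addr0 sqrtr_sqr.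
Qed.

Lemma rdot_ge0 x : 0 <= rdot x x.
Proof. by rewrite -rnorm_sqr sqr_ge0. Qed.

Lemma rdot_eq0 x : rdot x x = 0 -> x = 0.
Proof.
rewrite -rnorm_sqr => /eqP; rewrite sqrf_eq0 => /eqP; exact: rnorm_eq0.
Qed.

Lemma rdot_CS x y : `|rdot x y| <= rnorm x * rnorm y.
Proof.
have hx := rnorm_ge0 x; have hy := rnorm_ge0 y.
have h := rdot_ge0 ((rnorm y)%:C *: x - (rnorm x)%:C *: y).
have h' := rdot_ge0 ((rnorm y)%:C *: x + (rnorm x)%:C *: y).
move: h h'; rewrite !rdotE (rdotC y x) -!rnorm_sqr.
have [->|nx] := eqVneq x 0; first by rewrite rdot0l normr0 mulr_ge0 ?rnorm_ge0.
have [->|ny] := eqVneq y 0; first by rewrite rdot0r normr0 mulr_ge0 ?rnorm_ge0.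
have px : 0 < rnorm x.
  by rewrite lt0r hx andbT; apply: contra nx => /eqP /rnorm_eq0 ->.
have py : 0 < rnorm y.
  by rewrite lt0r hy andbT; apply: contra ny => /eqP /rnorm_eq0 ->.
have pq := mulr_gt0 px py.
move=> h h'; rewrite ler_norml; apply/andP; split; rewrite -(ler_pM2l pq).
  by clear h; nra.
by clear h'; nra.
Qed.

Lemma rdot_eqP x y : (forall z, rdot x z = rdot y z) -> x = y.
Proof.
move=> h; apply/eqP; rewrite -subr_eq0; apply/eqP/rdot_eq0.
by rewrite rdotDl rdotNl h subrr.
Qed.

Lemma cvgHP (u : nat -> H) (l : H) : u @ \oo --> l <->
  forall e : R, 0 < e -> exists N, forall n, (N <= n)%N -> rnorm (u n - l) < e.
Proof.
rewrite cvgrPdist_lt; split=> h e e0.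
  have : 0 < e%:C by rewrite ltcR.
  move=> /h [N _ hN]; exists N => n /hN /=.
  by rewrite rnormE ltcR rnorm_sub.
move: e0; rewrite ltcE /= => /andP[/eqP ei er].
have [N hN] := h _ er; exists N => // n /hN /=.
by rewrite rnormE rnorm_sub ltcE /= ei eqxx.
Qed.

Lemma cvg0P (u : nat -> R) : u @ \oo --> (0 : R) <->
  forall e : R, 0 < e -> exists N, forall n, (N <= n)%N -> `|u n| < e.
Proof.
rewrite cvgrPdist_lt; split=> h e /h [N].
  by move=> _ hN; exists N => n /hN /=; rewrite sub0r normrN.
by move=> hN; exists N => // n /hN /=; rewrite sub0r normrN.
Qed.

Lemma cvgH0 (u : nat -> H) (l : H) :
  u @ \oo --> l <-> (fun n => rnorm (u n - l)) @ \oo --> (0 : R).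
Proof.
rewrite cvgHP cvg0P; split=> h e /h [N hN]; exists N => n /hN.
  by rewrite ger0_norm ?rnorm_ge0.
by rewrite ger0_norm ?rnorm_ge0.
Qed.

Lemma cvgH_dominated (u : nat -> H) (d : nat -> R) (l : H) :
  (forall n, rnorm (u n - l) <= d n) -> d @ \oo --> (0 : R) -> u @ \oo --> l.
Proof.
move=> ud d0; apply/cvgH0; apply: (@squeeze_cvgr _ _ _ _ (fun=> 0) d) => //.
  by near=> n; rewrite rnorm_ge0 ud.
exact: cvg_cst.
Unshelve. all: by end_near. Qed.

Lemma cvgH_unique (u : nat -> H) (l l' : H) : u @ \oo --> l -> u @ \oo --> l' -> l = l'.
Proof. by move=> h h'; apply: (cvg_unique _ h h'); exact: norm_hausdorff. Qed.

Lemma cvgH_scale (c : R[i]) (u : nat -> H) (l : H) :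
  u @ \oo --> l -> (fun n => c *: u n) @ \oo --> c *: l.
Proof. by move=> h; apply: cvgZ => //; exact: cvg_cst. Qed.

Lemma cvgR_unique (u : nat -> R) (l l' : R) :
  u @ \oo --> l -> u @ \oo --> l' -> l = l'.
Proof. by move=> h h'; apply: (cvg_unique _ h h'); exact: Rhausdorff. Qed.

Lemma cvgH_eq (u v : nat -> H) (l l' : H) : (forall n, u n = v n) ->
  u @ \oo --> l -> v @ \oo --> l' -> l = l'.
Proof. by move=> /funext ->; exact: cvgH_unique. Qed.

Lemma cvgR_eq (u v : nat -> R) (l l' : R) : (forall n, u n = v n) ->
  u @ \oo --> l -> v @ \oo --> l' -> l = l'.
Proof. by move=> /funext ->; exact: cvgR_unique. Qed.

Lemma cvg_rnorm (u : nat -> H) (l : H) :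
  u @ \oo --> l -> (fun n => rnorm (u n)) @ \oo --> rnorm l.
Proof.
move=> /cvgH0 h; apply/cvgrPdist_lt => e e0.
have /cvg0P /(_ _ e0) [N hN] := h; exists N => // n /hN /=.
rewrite ger0_norm ?rnorm_ge0 // => ?.
have h1 := rnormD (u n - l) l; have h2 := rnormD (l - u n) (u n).
move: h1 h2; rewrite !subrK rnorm_sub => h1 h2.
move: h1; rewrite -rnorm_sub => h1; move: h2; rewrite rnorm_sub => h2.
by rewrite ltr_norml; apply/andP; split; lra.
Qed.

Lemma cvg_rdot (u v : nat -> H) (l m : H) : u @ \oo --> l -> v @ \oo --> m ->
  (fun n => rdot (u n) (v n)) @ \oo --> rdot l m.
Proof.
move=> hu hv.
have h : (fun n => rnorm (u n - l) * rnorm (v n) + rnorm l * rnorm (v n - m))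
    @ \oo --> (0 : R).
  rewrite [X in _ --> X](_ : _ = 0 * rnorm m + rnorm l * 0); last first.
    by rewrite mul0r mulr0 addr0.
  apply: cvgD; apply: cvgM.
  - by apply/cvgH0.
  - exact: cvg_rnorm.
  - exact: cvg_cst.
  - by apply/cvgH0.
apply/cvgrPdist_lt => e e0; have /cvg0P /(_ _ e0) [N hN] := h.
exists N => // n /hN /=; apply: le_lt_trans; rewrite [leRHS]ger0_norm; last first.
  by rewrite addr_ge0 // mulr_ge0 // rnorm_ge0.
have -> : rdot l m - rdot (u n) (v n) = - (rdot (u n - l) (v n) + rdot l (v n - m)).
  by rewrite !rdotE; ring.
by rewrite normrN (le_trans (ler_normD _ _)) // lerD // rdot_CS.
Qed.

Definition cauchyH (u : nat -> H) := forall e : R, 0 < e ->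
  exists N, forall n m, (N <= n)%N -> (N <= m)%N -> rnorm (u n - u m) < e.

Lemma cauchyH_cvg (u : nat -> H) : cauchyH u -> exists l : H, u @ \oo --> l.
Proof.
move=> cu; suff : cvg (u @ \oo) by move=> h; exists (lim (u @ \oo)).
apply: cauchy_cvg; apply: cauchy_exP => e.
rewrite ltcE /= => /andP[/eqP ei er].
have [N hN] := cu _ er; exists (u N); exists N => // n /= Nn.
rewrite -ball_normE /= rnormE ltcE /= ei eqxx /=; exact: hN.
Qed.

Lemma cvg_cauchyH (u : nat -> H) (l : H) : u @ \oo --> l -> cauchyH u.
Proof.
move=> /cvgHP h e e0; have [|N hN] := h (e / 2); first lra.
exists N => n m /hN h1 /hN h2; rewrite (le_lt_trans (rnorm_triangle _ l _)) //.
by rewrite (rnorm_sub l); lra.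
Qed.

End RealInnerProduct.

Arguments rdot {R H} dot x y.

(** For c > 0 the parabola is tested at its vertex -b / c. For c = 0 it is a line bounded below, so
    b = 0: otherwise the point -(a + 1) / (2 b) would give it the value -1. *)
Lemma discriminant_le (R : realType) (a b c : R) : 0 <= c ->
  (forall t, 0 <= a + 2 * t * b + t ^+ 2 * c) -> b ^+ 2 <= a * c.
Proof.
move=> c0 h; have [cz|cn] := eqVneq c 0.
  rewrite cz mulr0; have [->|b0] := eqVneq b 0; first by rewrite expr0n.
  have := h (- (a + 1) / (2 * b)); rewrite cz mulr0 addr0.
  have -> : a + 2 * (- (a + 1) / (2 * b)) * b = - 1 by field.
  by move=> ?; exfalso; lra.
have cp : 0 < c by rewrite lt0r cn.
have := h (- b / c).
have -> : a + 2 * (- b / c) * b + (- b / c) ^+ 2 * c = (a * c - b ^+ 2) / c by field.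
by rewrite pmulr_lge0 ?invr_gt0 // subr_ge0.
Qed.

(* Riesz representation in a space that need not be complete or separated:
   a minimizing sequence of s x x - 2 l x represents l in the limit. *)
Section RieszSequence.
Context {R : realType} {V : lmodType R[i]}.
Variables (D : set V) (s : V -> V -> R) (l : V -> R) (M : R).
Hypothesis D0 : D 0.
Hypothesis DP : forall (a : R[i]) x y, D x -> D y -> D (a *: x + y).
Hypothesis sC : forall x y, s x y = s y x.
Hypothesis sP : forall (a : R) x y z, s (a%:C *: x + y) z = a * s x z + s y z.
Hypothesis s_ge0 : forall x, D x -> 0 <= s x x.
Hypothesis lP : forall (a : R) x y, l (a%:C *: x + y) = a * l x + l y.
Hypothesis M_ge0 : 0 <= M.
Hypothesis l_bound : forall x, D x -> l x ^+ 2 <= M * s x x.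

Let J x := s x x - 2 * l x.

Let J_lb x : D x -> - M <= J x.
Proof.
move=> Dx; have sx := s_ge0 Dx; have lb := l_bound Dx.
rewrite /J; case: (lerP (2 * l x) (s x x + M)) => h; first lra.
(* The assumption 2 l > s + M >= 0 would give 4 l^2 > (s + M)^2 >= 4 M s. *)
exfalso; have h2 : 0 < (2 * l x - (s x x + M)) * (2 * l x + (s x x + M)).
  by apply: mulr_gt0; have h5 := M_ge0; lra.
by have := sqr_ge0 (s x x - M) => h3; nra.
Qed.

Let sPr (a : R) x y z : s z (a%:C *: x + y) = a * s z x + s z y.
Proof. by rewrite sC sP !(sC z). Qed.

Let J_line a x y :
  J (a%:C *: x + y) = J y + a ^+ 2 * s x x + 2 * a * (s y x - l x).
Proof. by rewrite /J !sP !sPr lP (sC x y); ring. Qed.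

(** The parallelogram law: the linear part of [J] cancels. Since [J] at the midpoint is at least its
    infimum, two near-minimizers are close with respect to s. *)
Let J_mid x y : s (x - y) (x - y) =
  2 * J x + 2 * J y - 4 * J ((2^-1)%:C *: x + (2^-1)%:C *: y).
Proof.
have hx a z w : s (a%:C *: z) w = a * s z w.
  have := sP a z 0 w; have := sP 1 0 0 w.
  by rewrite !addr0 scaler0 mul1r => h1 ->; move: h1 => ?; lra.
have hl a z : l (a%:C *: z) = a * l z.
  have := lP a z 0; have := lP 1 0 0.
  by rewrite !addr0 scaler0 mul1r => h1 ->; move: h1 => ?; lra.
have -> : x - y = (-1)%:C *: y + x.
  by rewrite rmorphN /= scaleN1r addrC.
by rewrite /J !sP !sPr lP !hx !hl !(sC _ (_ *: _)) !hx (sC y x); field.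
Qed.

Lemma riesz_sequence : exists u : nat -> V,
  [/\ forall n, D (u n),
      forall n m, s (u n - u m) (u n - u m) <= 2 / n.+1%:R + 2 / m.+1%:R
    & forall n x, D x -> (s (u n) x - l x) ^+ 2 <= s x x / n.+1%:R].
Proof.
pose B := [set J x | x in D].
have hB : has_inf B.
  split; first by exists (J 0); exists 0.
  by exists (- M) => _ [x Dx <-]; exact: J_lb.
have Jinf x : D x -> inf B <= J x.
  by move=> Dx; apply: ge_inf; [case: hB | exists x].
have /choice[u hu] n : exists x, D x /\ J x < inf B + n.+1%:R^-1.
  have n0 : 0 < (n.+1%:R^-1 : R) by rewrite invr_gt0.
  have [_ [x Dx <-] hx] := inf_adherent n0 hB.
  by exists x.
have Dm a b x y : D x -> D y -> D (a *: x + b *: y).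
  move=> Dx Dy; apply: DP => //; rewrite -[b *: y]addr0; exact: DP.
exists u; split=> [n|n m|n x Dx]; first by case: (hu n).
  have [Dn Jn] := hu n; have [Dp Jp] := hu m.
  have := Jinf _ (Dm (2^-1)%:C (2^-1)%:C _ _ Dn Dp).
  rewrite J_mid => h3; move: (J _) (J _) (J _) Jn Jp h3 => p q r.
  by move: (n.+1%:R^-1 : R) (m.+1%:R^-1 : R) (inf B : R) => a b i ? ? ?; lra.
have [Dn Jn] := hu n.
(* On the line u_n + a x, [J] stays above its infimum, which J (u_n) exceeds by less than 1 / (n +
   1). The discriminant of this quadratic in a is the claimed estimate. *)
have line a : 0 <= n.+1%:R^-1 + a ^+ 2 * s x x + 2 * a * (s (u n) x - l x).
  have := Jinf _ (DP a%:C Dx Dn); rewrite J_line.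
  by move: (n.+1%:R^-1 : R) (inf B : R) (J _) Jn => e i p ? ?; lra.
rewrite [leRHS]mulrC; apply: discriminant_le (s_ge0 Dx) _ => a.
by rewrite addrAC.
Qed.
End RieszSequence.

(** * Nonnegative selfadjoint relations and their resolvents *)

Section Resolvents.
Context {R : realType} {H : completeNormedModType R[i]}.
Context {dot : {dot H for (@Num.conj R[i])}} {dot_norm : inner_norm dot}.
Local Notation rd := (rdot dot).
Implicit Types (X : H -> H) (A B : set (H * H)).

Lemma inv_succ_small (e : R) : 0 < e -> exists N, forall n m,
  (N <= n)%N -> (N <= m)%N -> 2 / n.+1%:R + 2 / m.+1%:R < e.
Proof.
move=> e0; have e4 : 0 < e / 4 by lra.
have [N _ hN] := near_infty_natSinv_lt (PosNum e4).
exists N => n m /hN /= h1 /hN /= h2.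
by move: (n.+1%:R^-1 : R) (m.+1%:R^-1 : R) h1 h2 => a b ? ?; lra.
Qed.

Lemma inv_succ_cvg0 (c : R) : (fun n => c / n.+1%:R) @ \oo --> (0 : R).
Proof.
rewrite -[X in _ --> X](mulr0 c); apply: cvgM; first exact: cvg_cst.
apply/cvg0P => e e0; have [N _ hN] := near_infty_natSinv_lt (PosNum e0).
by exists N => n /hN /=; rewrite ger0_norm // invr_ge0.
Qed.

Lemma sqr_bound_cvg (u : nat -> R) (l c : R) :
  (forall n, (u n - l) ^+ 2 <= c / n.+1%:R) -> u @ \oo --> l.
Proof.
move=> h; apply/cvgrPdist_lt => e e0.
have /cvg0P/(_ (e ^+ 2)) [|N hN] := inv_succ_cvg0 c; first by rewrite exprn_gt0.
exists N => // n /hN /= h1; rewrite distrC -ltr_sqr ?nnegrE // ?ltW //.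
rewrite real_normK ?num_real //; apply: le_lt_trans (h n) _.
exact: le_lt_trans (ler_norm _) h1.
Qed.

Lemma closed_lim (A : set (H * H)) (u v : nat -> H) (l m : H) : closed A ->
  (forall n, A (u n, v n)) -> u @ \oo --> l -> v @ \oo --> m -> A (l, m).
Proof.
move=> Acl Au ul vm.
apply: (@closed_cvg _ _ \oo _ (fun n => (u n, v n)) A Acl).
  exact: nearW.
exact: cvg_pair.
Qed.

Lemma rnorm_lt_sqr x (e : R) : 0 < e -> rd x x < e ^+ 2 -> rnorm x < e.
Proof.
by move=> e0; rewrite -(rnorm_sqr (dot := dot)) ltr_sqr // nnegrE ?rnorm_ge0 // ltW.
Qed.

Lemma rdot_cauchyH (u : nat -> H) :
  (forall e : R, 0 < e -> exists N, forall n m, (N <= n)%N -> (N <= m)%N ->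
     rd (u n - u m) (u n - u m) < e) -> cauchyH u.
Proof.
move=> h e e0; have [|N hN] := h (e ^+ 2); first by rewrite exprn_gt0.
by exists N => n m /hN h1 /h1; exact: rnorm_lt_sqr.
Qed.

Lemma rdot_CS_sqr (x y : H) : rd x y ^+ 2 <= rd x x * rd y y.
Proof.
rewrite -!(rnorm_sqr (dot := dot)) -exprMn -real_normK ?num_real //.
by rewrite ler_sqr ?nnegrE ?mulr_ge0 ?rnorm_ge0 // (rdot_CS (dot := dot)).
Qed.

Lemma contraction_cvg (X : H -> H) (u : nat -> H) l :
  (forall x y, X (x - y) = X x - X y) -> (forall x, rnorm (X x) <= rnorm x) ->
  u @ \oo --> l -> X \o u @ \oo --> X l.
Proof.
move=> XB Xc /cvgH0; apply: cvgH_dominated => n /=.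
by rewrite -XB.
Qed.

(** With f = X x and f' = x - X x the last condition says (f', f) >= 0; for symmetric X it amounts
    to 0 <= X <= I. Symmetry of the real part suffices because X is complex linear. *)
Definition is_resolvent X : Prop :=
  [/\ forall a x y, X (a *: x + y) = a *: X x + X y,
      forall x y, rd (X x) y = rd x (X y)
    & forall x, rd (X x) (X x) <= rd (X x) x].

(* The relation A with (A + I)^-1 = X. *)
Definition res_rel X : set (H * H) := [set p | X (p.1 + p.2) = p.1].

Section LinearMaps.
Variable X : H -> H.
Hypothesis XL : forall a x y, X (a *: x + y) = a *: X x + X y.

Lemma linmapD x y : X (x + y) = X x + X y.
Proof. by have := XL 1 x y; rewrite !scale1r. Qed.
Lemma linmap0 : X 0 = 0.
Proof. by apply: (addIr (X 0)); rewrite -linmapD addr0 add0r. Qed.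
Lemma linmapZ a x : X (a *: x) = a *: X x.
Proof. by have := XL a x 0; rewrite linmap0 !addr0. Qed.
Lemma linmapN x : X (- x) = - X x.
Proof. by rewrite -scaleN1r linmapZ scaleN1r. Qed.
Lemma linmapB x y : X (x - y) = X x - X y.
Proof. by rewrite linmapD linmapN. Qed.
End LinearMaps.

Section OneResolvent.
Variable X : H -> H.
Hypothesis hX : is_resolvent X.

Lemma res_lin a x y : X (a *: x + y) = a *: X x + X y.
Proof. by case: hX. Qed.
Lemma res_sym x y : rd (X x) y = rd x (X y).
Proof. by case: hX. Qed.
Lemma res_firm x : rd (X x) (X x) <= rd (X x) x.
Proof. by case: hX. Qed.

Lemma resD x y : X (x + y) = X x + X y. Proof. exact: (linmapD res_lin). Qed.
Lemma res0 : X 0 = 0. Proof. exact: (linmap0 res_lin). Qed.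
Lemma resZ a x : X (a *: x) = a *: X x. Proof. exact: (linmapZ res_lin). Qed.
Lemma resB x y : X (x - y) = X x - X y. Proof. exact: (linmapB res_lin). Qed.

Lemma res_ge0 x : 0 <= rd (X x) x.
Proof. exact: le_trans (rdot_ge0 _) (res_firm x). Qed.

Lemma res_contr x : rnorm (X x) <= rnorm x.
Proof.
have h : rd (X x) (X x) <= rnorm (X x) * rnorm x.
  exact: le_trans (res_firm x) (le_trans (ler_norm _) (rdot_CS _ _)).
move: h; rewrite -(rnorm_sqr (dot := dot)).
have := rnorm_ge0 (X x); have := rnorm_ge0 x.
move: (rnorm (X x)) (rnorm x) => a b b0 a0 h.
have [->//|an] := eqVneq a 0.
have ap : 0 < a by rewrite lt0r an.
by rewrite -(ler_pM2l ap) -[a * a]expr2.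
Qed.

Lemma res_cvg (u : nat -> H) l : u @ \oo --> l -> X \o u @ \oo --> X l.
Proof. by apply: contraction_cvg; [exact: resB | exact: res_contr]. Qed.

(** If X = (A + I)^-1, then I - X = (A^-1 + I)^-1, see [inv_res_rel]. The last condition reads (X x,
    x - X x) >= 0, which is unchanged under X -> I - X. *)
Lemma res_compl : is_resolvent (fun x => x - X x).
Proof.
split=> [a x y|x y|x].
- by rewrite res_lin scalerBr opprD addrACA.
- by rewrite !rdotE res_sym.
- pose proof (res_firm x) as h1; move: h1.
  by rewrite !rdotE (rdotC x (X x)) => h1; lra.
Qed.

Lemma inv_res_rel : inv_rel (res_rel X) = res_rel (fun x => x - X x).
Proof.
apply/seteqP; split=> -[f g]; rewrite /inv_rel /res_rel /= => h.
  by rewrite (addrC f) h addrAC subrr add0r.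
by rewrite (addrC g) -[LHS](subKr (f + g)) h addrAC subrr add0r.
Qed.

Lemma resolvent_res_rel : resolvent (res_rel X) = X.
Proof.
apply/funext => x; rewrite /resolvent; case: xgetP => [y ->|/(_ (X x))].
  by move=> [[f g] /= h [<- <-]]; rewrite addrC h.
case; exists (X x, x - X x); last by rewrite /= subrK.
by rewrite /res_rel /= addrCA subrr addr0.
Qed.

Lemma res_relP x : res_rel X (X x, x - X x).
Proof. by rewrite /res_rel /= addrCA subrr addr0. Qed.

Lemma res_rel_sym p q : res_rel X p -> res_rel X q -> rd p.2 q.1 = rd p.1 q.2.
Proof.
move=> hp hq; have := res_sym (p.1 + p.2) (q.1 + q.2).
by rewrite hp hq !rdotE => h; lra.
Qed.

Lemma res_rel_ge0 p : res_rel X p -> 0 <= rd p.2 p.1.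
Proof.
move=> hp; have := res_firm (p.1 + p.2).
by rewrite hp !rdotE (rdotC p.1 p.2) => h; lra.
Qed.

End OneResolvent.

Lemma res_relI X Y : res_rel X = res_rel Y -> X = Y.
Proof. by move=> h; rewrite -(resolvent_res_rel X) h resolvent_res_rel. Qed.

(** Testing with i f besides f recovers the imaginary part of the defining equation. *)
Lemma adjointP A g :
  (forall (a : R[i]) (p q : H * H), A p -> A q ->
        A (a *: p.1 + q.1, a *: p.2 + q.2)) -> A (0, 0) ->
  (adjoint dot A g <-> forall f, A f -> rd f.2 g.1 = rd f.1 g.2).
Proof.
move=> AL A0; split=> h f Af; first by rewrite /rdot h.
rewrite !(dotE (dot := dot)) (h f Af).
have := h _ (AL 'i f (0,0) Af A0); rewrite /= !addr0 !rdotil => /oppr_inj ->.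
by [].
Qed.

Lemma nonneg_relP A : 
  (forall p q, A p -> A q -> rd p.2 q.1 = rd p.1 q.2) ->
  (forall (a : R[i]) (p q : H * H), A p -> A q ->
        A (a *: p.1 + q.1, a *: p.2 + q.2)) -> A (0, 0) ->
  (nonneg_rel dot A <-> forall f, A f -> 0 <= rd f.2 f.1).
Proof.
move=> As AL A0; split=> h f Af.
  by have := h f Af; rewrite lecE => /andP[].
rewrite (dotE (dot := dot)) lecE /= h // andbT.
have := As _ _ Af (AL 'i f (0,0) Af A0); rewrite /= !addr0 => e.
have := rdotil (dot := dot) f.1 f.2.
by rewrite (rdotC ('i *: f.1)) -e => h1; apply/eqP; rewrite /=; lra.
Qed.

Lemma contraction_continuous X : (forall x y, X (x - y) = X x - X y) ->
  (forall x, rnorm (X x) <= rnorm x) -> continuous X.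
Proof.
move=> XB Xc x; apply/cvgrPdist_lt => e e0; near=> y.
rewrite -XB; apply: (@le_lt_trans _ _ `|x - y|).
  by rewrite !rnormE lecR.
by near: y; apply: cvgr_dist_lt.
Unshelve. all: by end_near. Qed.

Lemma closed_zero (f : H * H -> H) : continuous f -> closed [set p | f p = 0].
Proof.
move=> cf; apply: (@preimage_closed _ _ f [set 0]).
  by move=> x _; exact: cf.
exact: accessible_closed_set1 (hausdorff_accessible (@norm_hausdorff _ _)) _.
Qed.

Lemma nsa_res_rel X : is_resolvent X -> nonneg_selfadjoint dot (res_rel X).
Proof.
move=> hX.
have r0 : res_rel X (0, 0) by rewrite /res_rel /= addr0 (res0 hX).
have rL (a : R[i]) (p q : H * H) : res_rel X p -> res_rel X q ->
        res_rel X (a *: p.1 + q.1, a *: p.2 + q.2).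
  by rewrite /res_rel /= => hp hq; rewrite addrACA -scalerDr (res_lin hX) hp hq.
have rs := res_rel_sym hX.
split; last by apply/nonneg_relP => // f; exact: res_rel_ge0.
- split=> //.
  rewrite [X in closed X](_ : _ = [set p | X (p.1 + p.2) - p.1 = 0]); last first.
    apply/seteqP; split=> p; rewrite /res_rel /=; first by move=> ->; exact: subrr.
    by move=> /eqP; rewrite subr_eq0 => /eqP.
  apply: closed_zero => p; apply: cvgB; last exact: cvg_fst.
  have c1 : (q.1 + q.2) @[q --> p] --> (p.1 + p.2).
    by apply: cvgD; (exact: cvg_fst || exact: cvg_snd).
  apply: (cvg_comp _ _ c1).
  exact: (contraction_continuous (resB hX) (res_contr hX)).
- rewrite setXTT setIT; apply/seteqP; split=> p.
    by move=> hp; apply/adjointP => // f hf; exact: rs.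
  move=> /(adjointP _ rL r0) h; rewrite /res_rel /=.
  apply: (@rdot_eqP _ _ dot) => x.
  (* Testing p against (X x, x - X x) gives (X (p.1 + p.2), x) = (p.1, x) for every x. *)
  have := h _ (res_relP X x).
  rewrite (res_sym hX) /= !rdotE (rdotC p.2) (rdotC p.1 x) (rdotC p.1 (X x)).
  by move=> h1; lra.
Qed.

(** The point is that A + I is onto. Riesz is applied on A with the form |f + f'|^2, which dominates
    |f|^2 and |f'|^2 because (f', f) >= 0. The residual r of h is orthogonal to ran (A + I), so (r,
    -r) lies in the adjoint, that is in A, and nonnegativity forces r = 0. *)
Lemma nsaP A : nonneg_selfadjoint dot A ->
  exists2 X, is_resolvent X & A = res_rel X.
Proof.
move=> [[A0 AL Acl]]; rewrite setXTT setIT => Aadj Apos.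
have Asym p q : A p -> A q -> rd p.2 q.1 = rd p.1 q.2.
  by move=> Ap; rewrite Aadj => /(adjointP _ AL A0); exact.
have Age0 p : A p -> 0 <= rd p.2 p.1 by apply: (proj1 (nonneg_relP Asym AL A0) Apos).
have AB p q : A p -> A q -> A (p.1 - q.1, p.2 - q.2).
  by move=> Ap Aq; have := AL (-1) q p Aq Ap; rewrite !scaleN1r ![- _ + _]addrC.
have uniq h y z : A (y, h - y) -> A (z, h - z) -> y = z.
  move=> /AB h1 /h1 /Age0 /=.
  have -> : h - y - (h - z) = - (y - z).
    by rewrite opprD [in LHS]opprK addrACA subrr add0r opprB addrC.
  rewrite rdotNl oppr_ge0 => h2; apply/eqP; rewrite -subr_eq0; apply/eqP.
  by apply: (rdot_eq0 (dot := dot)); apply/eqP; rewrite eq_le h2 rdot_ge0.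
have /choice[X hX] h : exists y, A (y, h - y).
  pose sm (p : H * H) := p.1 + p.2.
  have [] := @riesz_sequence R (H * H)%type A
    (fun p q => rd (sm p) (sm q)) (fun p => rd h (sm p)) (rd h h).
  - exact: A0.
  - by move=> a p q; exact: AL.
  - by move=> p q; rewrite rdotC.
  - by move=> a p q r; rewrite -rdotZl -rdotDl /sm /= scalerDr addrACA.
  - by move=> p _; exact: rdot_ge0.
  - by move=> a p q; rewrite -rdotZr -rdotDr /sm /= scalerDr addrACA.
  - exact: rdot_ge0.
  - by move=> p _; exact: rdot_CS_sqr.
  move=> u [uA uC ul].
  have sm_ge p : A p -> rd p.1 p.1 <= rd (sm p) (sm p) /\ rd p.2 p.2 <= rd (sm p) (sm p).
    move=> /Age0; rewrite /sm !rdotE (rdotC p.1 p.2).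
    pose proof (rdot_ge0 p.1) as h1; pose proof (rdot_ge0 p.2) as h2.
    by move=> h3; split; lra.
  have c1 : cauchyH (fun n => (u n).1).
    apply: rdot_cauchyH => e /inv_succ_small [N hN]; exists N => n m Nn Nm.
    apply: le_lt_trans (hN _ _ Nn Nm); apply: le_trans (uC _ _).
    by have [] := sm_ge _ (AB _ _ (uA n) (uA m)).
  have c2 : cauchyH (fun n => (u n).2).
    apply: rdot_cauchyH => e /inv_succ_small [N hN]; exists N => n m Nn Nm.
    apply: le_lt_trans (hN _ _ Nn Nm); apply: le_trans (uC _ _).
    by have [] := sm_ge _ (AB _ _ (uA n) (uA m)).
  have [y hy] := cauchyH_cvg c1; have [y' hy'] := cauchyH_cvg c2.
  have Ay : A (y, y').
    by apply: closed_lim Acl _ hy hy' => n; rewrite -surjective_pairing.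
  exists y; suff <- : y' = h - y by [].
  have ort p : A p -> rd (y + y') (sm p) = rd h (sm p).
    move=> Ap.
    have l1 : (fun n => rd (sm (u n)) (sm p)) @ \oo --> rd (y + y') (sm p).
      by apply: cvg_rdot; [apply: cvgD | exact: cvg_cst].
    exact: cvgR_unique l1 (sqr_bound_cvg (fun n => ul n p Ap)).
  have /Age0 : A (h - (y + y'), - (h - (y + y'))).
    rewrite Aadj; apply/(adjointP _ AL A0) => p /ort h1 /=.
    have := rdotDl (dot := dot) (h - (y + y')) 0 (sm p); rewrite addr0 rdot0l addr0.
    move: h1; rewrite /sm !rdotE (rdotC p.2) (rdotC p.1) => h1 _.
    by rewrite !(rdotC p.1) !(rdotC p.2); lra.
  rewrite /= rdotNl oppr_ge0 => h2.
  have : h - (y + y') = 0.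
    by apply: (rdot_eq0 (dot := dot)); apply/eqP; rewrite eq_le h2 rdot_ge0.
  by rewrite opprD addrA => /eqP; rewrite subr_eq0 => /eqP ->.
exists X.
  split.
  - move=> a x y; apply: (uniq (a *: x + y)) => //.
    have := AL a _ _ (hX x) (hX y) => /=.
    by rewrite scalerBr addrACA opprD.
  - move=> x y; have /= := Asym _ _ (hX x) (hX y).
    by rewrite !rdotE => h; lra.
  - move=> x; have /= := Age0 _ (hX x).
    by rewrite rdotDl rdotNl (rdotC x) => h; lra.
apply/seteqP; split=> -[p q]; rewrite /res_rel /=.
  move=> Apq; apply: (uniq (p + q)); first exact: hX.
  by rewrite addrAC subrr add0r.
by move=> h; have := hX (p + q); rewrite h addrAC subrr add0r.
Qed.

End Resolvents.
Arguments is_resolvent {R H} dot X.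

(** * Square roots *)

Section SquareRoot.
Context {R : realType} {H : completeNormedModType R[i]}.
Context {dot : {dot H for (@Num.conj R[i])}} {dot_norm : inner_norm dot}.
Local Notation rd := (rdot dot).
Local Notation is_res := (is_resolvent dot).

Lemma positive_CS (W : H -> H) x y : (forall a x y, W (a *: x + y) = a *: W x + W y) ->
  (forall x y, rd (W x) y = rd x (W y)) -> (forall x, 0 <= rd (W x) x) ->
  rd (W x) y ^+ 2 <= rd (W x) x * rd (W y) y.
Proof.
move=> WL Ws W0; apply: discriminant_le => // t.
have := W0 (t%:C *: y + x); rewrite WL !rdotE (rdotC (W y) x) -Ws => h.
by lra.
Qed.

(** By [positive_CS] at x and W x, |W x|^4 <= (W x, x) (W W x, W x) <= (W x, x) |W x|^2. *)
Lemma positive_resolvent (W : H -> H) :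
  (forall a x y, W (a *: x + y) = a *: W x + W y) ->
  (forall x y, rd (W x) y = rd x (W y)) -> (forall x, 0 <= rd (W x) x <= rd x x) ->
  is_res W.
Proof.
move=> WL Ws W01; split=> // x.
have W0 y : 0 <= rd (W y) y by have /andP[] := W01 y.
pose proof (positive_CS x (W x) WL Ws W0) as h; move: h.
have /andP[_] := W01 (W x); have := W0 x; pose proof (rdot_ge0 (W x)) as h; move: h.
move: (rd (W x) (W x)) (rd (W x) x) (rd (W (W x)) (W x)) => a b c a0 b0 ca h.
have [->//|an] := eqVneq a 0.
have ap : 0 < a by rewrite lt0r an.
rewrite -(ler_pM2l ap); nra.
Qed.

(* With Z = I - X the iterates converge to Y with 2 Y = Z + Y^2, so that
   (I - Y)^2 = X. The same recursion for the scalar 1 majorizes the norms of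
   the increments and converges. *)
Fixpoint sqrt_iter (Z : H -> H) (n : nat) : H -> H :=
  if n is m.+1 then fun x => (2^-1)%:C *: (Z x + sqrt_iter Z m (sqrt_iter Z m x))
  else fun=> 0.

Fixpoint sqrt_major (n : nat) : R :=
  if n is m.+1 then (1 + sqrt_major m ^+ 2) / 2 else 0.

Lemma sqrt_major_itv n : 0 <= sqrt_major n <= 1.
Proof.
elim: n => [|n /andP[h0 h1]] /=; first by rewrite lexx ler01.
by apply/andP; split; nra.
Qed.

Lemma sqrt_major_incr n : sqrt_major n <= sqrt_major n.+1.
Proof.
elim: n => [|n IH] /=; first lra.
have /andP[h0 _] := sqrt_major_itv n; have /andP[h2 _] := sqrt_major_itv n.+1.
rewrite /= in IH h2 *; nra.
Qed.

Section Iteration.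
Variable Z : H -> H.
Hypothesis hZ : is_res Z.
Local Notation Y := (sqrt_iter Z).

Lemma sqrt_iter_lin n a x y : Y n (a *: x + y) = a *: Y n x + Y n y.
Proof.
elim: n a x y => [|n IH] a x y /=; first by rewrite scaler0 addr0.
rewrite !IH (res_lin hZ) addrACA -[a *: _ + a *: _]scalerDr [LHS]scalerDr !scalerA.
by rewrite [a * _]mulrC.
Qed.

Lemma sqrt_iter_sym n x y : rd (Y n x) y = rd x (Y n y).
Proof.
elim: n x y => [|n IH] x y /=; first by rewrite rdot0l rdot0r.
by rewrite !rdotE (res_sym hZ) !IH.
Qed.

Lemma sqrt_iter_comm (W : H -> H) :
  (forall a x y, W (a *: x + y) = a *: W x + W y) ->
  (forall x, W (Z x) = Z (W x)) -> forall n x, W (Y n x) = Y n (W x).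
Proof.
move=> WL WZ; elim=> [|n IH] x /=; first exact: (linmap0 WL).
by rewrite (linmapZ WL) (linmapD WL) WZ !IH.
Qed.

Lemma sqrt_iter_bound n x : rnorm (Y n x) <= sqrt_major n * rnorm x.
Proof.
elim: n x => [|n IH] x /=; first by rewrite rnorm0 mul0r.
rewrite rnormZ ger0_norm ?invr_ge0 //.
pose proof (res_contr hZ x) as h2; have h1 := rnormD (Z x) (Y n (Y n x)).
have h3 := IH (Y n x); have h4 := IH x; have /andP[h5 _] := sqrt_major_itv n.
by have h6 := ler_wpM2l h5 h4; lra.
Qed.

Lemma sqrt_iter_step n x :
  rnorm (Y n.+1 x - Y n x) <= (sqrt_major n.+1 - sqrt_major n) * rnorm x.
Proof.
elim: n x => [|n IH] x.
  by rewrite /= !subr0; exact: (sqrt_iter_bound 1).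
(* The difference of squares is split as Y_{n+1} (Y_{n+1} - Y_n) + (Y_{n+1} - Y_n) Y_n; the majorant
   factors in the same way. *)
have -> : Y n.+2 x - Y n.+1 x =
    (2^-1)%:C *: (Y n.+1 (Y n.+1 x - Y n x) + (Y n.+1 (Y n x) - Y n (Y n x))).
  rewrite (linmapB (sqrt_iter_lin n.+1)) subrKA.
  by rewrite [Y n.+2 x]/= [Y n.+1 x in LHS]/= -scalerBr
    opprD addrACA subrr add0r.
rewrite rnormZ ger0_norm ?invr_ge0 //.
have h1 := rnormD (Y n.+1 (Y n.+1 x - Y n x)) (Y n.+1 (Y n x) - Y n (Y n x)).
pose proof (sqrt_iter_bound n.+1 (Y n.+1 x - Y n x)) as h2.
pose proof (sqrt_iter_bound n x) as h4; have h3 := IH (Y n x); have h5 := IH x.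
have /andP[b0 _] := sqrt_major_itv n.+1.
have d0 : 0 <= sqrt_major n.+1 - sqrt_major n by rewrite subr_ge0 sqrt_major_incr.
have h6 := ler_wpM2l b0 h5; have h7 := ler_wpM2l d0 h4.
have -> : sqrt_major n.+2 - sqrt_major n.+1 =
  (sqrt_major n.+1 - sqrt_major n) * (sqrt_major n.+1 + sqrt_major n) / 2.
  by rewrite /=; field.
move: (sqrt_major n.+1) (sqrt_major n) h2 h3 h6 h7 => a b h2 h3 h6 h7.
by lra.
Qed.

Lemma sqrt_iter_diff n k x :
  rnorm (Y (k + n) x - Y n x) <= (sqrt_major (k + n) - sqrt_major n) * rnorm x.
Proof.
elim: k => [|k IH]; first by rewrite !subrr rnorm0 mul0r.
apply: le_trans (rnorm_triangle _ (Y (k + n) x) _) _.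
apply: le_trans (lerD (sqrt_iter_step _ _) IH) _.
by rewrite -mulrDl addSn addrA subrK.
Qed.

Lemma sqrt_iter_cvg x : exists y : H, (fun n => Y n x) @ \oo --> y.
Proof.
apply: cauchyH_cvg => e e0.
have cm : cvgn sqrt_major.
  apply: nondecreasing_is_cvgn; first by apply/nondecreasing_seqP; exact: sqrt_major_incr.
  by exists 1 => _ [n _ <-]; have /andP[] := sqrt_major_itv n.
(* The summand 1 keeps the divisor positive when x = 0. *)
have r1 : 0 < 2 * (rnorm x + 1) by have := rnorm_ge0 x; lra.
have e1 : 0 < e / (2 * (rnorm x + 1)) by exact: divr_gt0.
have /cvgrPdist_lt /(_ _ e1) [N _ hN] := cm.
have hd n : (N <= n)%N -> rnorm (Y n x - Y N x) < e / 2.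
  move=> Nn; pose proof (sqrt_iter_diff N (n - N) x) as h; move: h; rewrite subnK //.
  move=> h; apply: le_lt_trans h _.
  have incr := nondecreasing_cvgn_le _ cm.
  have h1 := hN N (leqnn N); rewrite /= in h1.
  have le1 : sqrt_major n <= limn sqrt_major.
    by apply: incr; apply/nondecreasing_seqP; exact: sqrt_major_incr.
  have h2 : sqrt_major n - sqrt_major N < e / (2 * (rnorm x + 1)).
    by apply: le_lt_trans h1; apply: le_trans (ler_norm _); rewrite lerD2r.
  have x0 := rnorm_ge0 x.
  have e2 : e / 2 = e / (2 * (rnorm x + 1)) * (rnorm x + 1).
    by field; apply/eqP => ?; lra.
  rewrite e2; move: (e / _) h2 e1 => d ? ?; nra.
exists N => n m /hd h1 /hd h2; apply: le_lt_trans (rnorm_triangle _ (Y N x) _) _.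
by move: h2; rewrite rnorm_sub => h2; lra.
Qed.

End Iteration.

(** The commutation clause lets the roots of X, of I - X and of the root of X commute with each
    other in [root_exists]. It passes to the limit from the iterates, which are polynomials in I -
    X. *)
Lemma resolvent_sqrt (X : H -> H) : is_res X -> exists C : H -> H,
  [/\ is_res C, forall x, C (C x) = X x
    & forall W : H -> H, (forall a x y, W (a *: x + y) = a *: W x + W y) ->
       (forall x, rnorm (W x) <= rnorm x) -> (forall x, W (X x) = X (W x)) ->
       forall x, W (C x) = C (W x)].
Proof.
move=> hX; pose Z x := x - X x; have hZ : is_res Z := res_compl hX.
have /choice[Y hY] := sqrt_iter_cvg hZ.
pose Yn := sqrt_iter Z.
have Yc x : rnorm (Y x) <= rnorm x.
  apply: (ler_cvg_to (cvg_rnorm (hY x)) (cvg_cst (rnorm x))).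
  apply: nearW => n; apply: le_trans (sqrt_iter_bound hZ n x) _.
  by apply: ler_piMl; [exact: rnorm_ge0 | have /andP[] := sqrt_major_itv n].
have YL a x y : Y (a *: x + y) = a *: Y x + Y y.
  exact: (cvgH_eq (fun n => sqrt_iter_lin hZ n a x y) (hY _)
    (cvgD (cvgH_scale (c:=a) (hY x)) (hY y))).
have Ys x y : rd (Y x) y = rd x (Y y).
  exact: (cvgR_eq (fun n => sqrt_iter_sym hZ n x y)
    (cvg_rdot (hY x) (cvg_cst y)) (cvg_rdot (cvg_cst x) (hY y))).
have Yeq x : Y x = (2^-1)%:C *: (Z x + Y (Y x)).
  have h1 : (fun n => Yn n.+1 x) @ \oo --> Y x.
    apply/cvgHP => e e0; have /cvgHP/(_ e e0)[N hN] := hY x.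
    by exists N => n Nn; apply: hN; exact: leqW.
  apply: (cvgH_unique h1) => /=.
  apply: cvgH_scale; apply: (cvgD (cvg_cst _)).
  (* Since Y_n is a contraction, |Y_n Y_n x - Y Y x| <= |Y_n x - Y x| + |(Y_n - Y) (Y x)|. *)
  have h2 : (fun n => rnorm (Yn n x - Y x) + rnorm (Yn n (Y x) - Y (Y x)))
      @ \oo --> (0 : R).
    by rewrite -[X in _ --> X](addr0 0); apply: cvgD; apply/cvgH0; exact: hY.
  apply: cvgH_dominated h2 => n.
  apply: le_trans (rnorm_triangle _ (Yn n (Y x)) _) _; rewrite lerD2r.
  rewrite -(linmapB (sqrt_iter_lin hZ n)); apply: le_trans (sqrt_iter_bound hZ n _) _.
  by apply: ler_piMl; [exact: rnorm_ge0 | have /andP[] := sqrt_major_itv n].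
exists (fun x => x - Y x); split.
- apply: positive_resolvent => [a x y|x y|x].
  + by rewrite YL scalerBr opprD addrACA.
  + by rewrite !rdotE Ys.
  + rewrite rdotDl rdotNl; apply/andP; split.
      rewrite subr_ge0; apply: le_trans (ler_norm _) _.
      apply: le_trans (rdot_CS _ _) _.
      by rewrite -rnorm_sqr expr2 ler_wpM2r // rnorm_ge0.
    (* (Y x, x) >= 0, because it equals ((Z x, x) + |Y x|^2) / 2. *)
    rewrite gerBl Yeq rdotZl rdotDl Ys.
    by rewrite mulr_ge0 // ?invr_ge0 // addr_ge0 ?rdot_ge0 // (res_ge0 hZ).
- move=> x; have h := Yeq x.
  have h2 : Y x + Y x = Z x + Y (Y x).
    rewrite {1 2}h -scalerDl -rmorphD /= (_ : 2^-1 + 2^-1 = 1) ?scale1r //.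
    by field.
  rewrite (linmapB YL) (_ : Y (Y x) = Y x + Y x - Z x); last first.
    by rewrite h2 addrC addKr.
  have -> : Y x - (Y x + Y x - Z x) = Z x - Y x.
    by rewrite opprB addrCA opprD !addrA addrK.
  by rewrite opprB addrA subrK /Z subKr.
- move=> W WL Wc WX x; rewrite (linmapB WL); congr (_ - _).
  have hW := contraction_cvg (linmapB WL) Wc (hY x).
  have WZ y : W (Z y) = Z (W y) by rewrite (linmapB WL) WX.
  exact: (cvgH_eq (fun n => sqrt_iter_comm WL WZ n x) hW (hY (W x))).
Qed.

End SquareRoot.

(** * Forms |G f|^2 of closed graphs and their resolvents *)

Section ClosedGraphs.
Context {R : realType} {H : completeNormedModType R[i]}.
Context {dot : {dot H for (@Num.conj R[i])}} {dot_norm : inner_norm dot}.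
Local Notation rd := (rdot dot).
Local Notation is_res := (is_resolvent dot).

Lemma closure_seq (A : set (H * H)) p : closure A p -> exists u : nat -> H * H,
  [/\ forall n, A (u n), (fun n => (u n).1) @ \oo --> p.1
    & (fun n => (u n).2) @ \oo --> p.2].
Proof.
move=> cp.
have /choice[u hu] n : exists q, [/\ A q, rnorm (q.1 - p.1) < n.+1%:R^-1
    & rnorm (q.2 - p.2) < n.+1%:R^-1].
  have n0 : 0 < (n.+1%:R^-1)%:C :> R[i] by rewrite ltcR invr_gt0.
  have [q [Aq [b1 b2]]] := cp _ (nbhsx_ballx p _ n0); exists q.
  move: b1 b2; rewrite -!ball_normE /= !rnormE !ltcR => b1 b2.
  by split; rewrite // rnorm_sub.
have lim0 := inv_succ_cvg0 (R := R) 1.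
exists u; split=> [n||]; first by case: (hu n).
- by apply: cvgH_dominated lim0 => n; case: (hu n) => _ h _; rewrite div1r ltW.
- by apply: cvgH_dominated lim0 => n; case: (hu n) => _ _ h; rewrite div1r ltW.
Qed.

Lemma closed_seq (A : set (H * H)) :
  (forall (u v : nat -> H) (l m : H), (forall n, A (u n, v n)) ->
     u @ \oo --> l -> v @ \oo --> m -> A (l, m)) -> closed A.
Proof.
move=> h p /closure_seq [u [Au u1 u2]]; rewrite (surjective_pairing p).
by apply: h u1 u2 => n; rewrite -surjective_pairing.
Qed.

Lemma linear_relB (A : set (H * H)) p q : linear_relation A ->
  A p -> A q -> A (p.1 - q.1, p.2 - q.2).
Proof.
move=> [_ AL _] Ap Aq; have := AL (-1) q p Aq Ap.
by rewrite !scaleN1r ![- _ + _]addrC.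
Qed.

(** p is the orthogonal projection of (h, 0) onto G in the Hilbert space H + H. *)
Lemma graph_projection (G : set (H * H)) h : linear_relation G ->
  exists2 p, G p & forall q, G q -> rd p.1 q.1 + rd p.2 q.2 = rd h q.1.
Proof.
move=> linG; have [G0 GL Gcl] := linG.
have [] := @riesz_sequence R (H * H)%type G
  (fun p q => rd p.1 q.1 + rd p.2 q.2) (fun p => rd h p.1) (rd h h).
- exact: G0.
- by move=> a p q; exact: GL.
- by move=> p q; rewrite rdotC (rdotC p.2).
- by move=> a p q r /=; rewrite !rdotE; ring.
- by move=> p _; rewrite addr_ge0 // rdot_ge0.
- by move=> a p q /=; rewrite !rdotE.
- exact: rdot_ge0.
- move=> p _; apply: le_trans (rdot_CS_sqr _ _) _.
  by rewrite ler_wpM2l ?rdot_ge0 // lerDl rdot_ge0.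
move=> u [uG uC ul].
have c1 : cauchyH (fun n => (u n).1).
  apply: rdot_cauchyH => e /inv_succ_small [N hN]; exists N => n m Nn Nm.
  apply: le_lt_trans (hN _ _ Nn Nm); apply: le_trans (uC _ _).
  by rewrite lerDl rdot_ge0.
have c2 : cauchyH (fun n => (u n).2).
  apply: rdot_cauchyH => e /inv_succ_small [N hN]; exists N => n m Nn Nm.
  apply: le_lt_trans (hN _ _ Nn Nm); apply: le_trans (uC _ _).
  by rewrite lerDr rdot_ge0.
have [y hy] := cauchyH_cvg c1; have [y' hy'] := cauchyH_cvg c2.
exists (y, y').
  by apply: closed_lim Gcl _ hy hy' => n; rewrite -surjective_pairing.
move=> q Gq; apply: (@cvgR_unique _ (fun n => rd (u n).1 q.1 + rd (u n).2 q.2)).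
  by apply: cvgD; apply: cvg_rdot => //; exact: cvg_cst.
exact: sqr_bound_cvg (fun n => ul n q Gq).
Qed.

(* The closed form of the relation with resolvent X: f belongs to the domain
   and has value c iff f is the limit of X h_n along a form-Cauchy sequence. *)
Definition res_form (X : H -> H) (f : H) (c : R) : Prop :=
  exists h : nat -> H,
    [/\ (X \o h) @ \oo --> f,
        forall e : R, 0 < e -> exists N, forall n m, (N <= n)%N -> (N <= m)%N ->
          rd (X (h n - h m)) (h n - h m) < e
      & (fun n => rd (X (h n)) (h n)) @ \oo --> c + rd f f].

(** The bound puts f in the form domain: it makes (f, .) continuous for the seminorm (X k, k), and
    the sequence representing this functional has X h_n --> f. *)
Lemma riesz_res X f (M : R) : is_res X -> 0 <= M ->
  (forall k, rd f k ^+ 2 <= M * rd (X k) k) ->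
  exists h : nat -> H,
    [/\ (X \o h) @ \oo --> f
      & forall e : R, 0 < e -> exists N, forall n m, (N <= n)%N -> (N <= m)%N ->
          rd (X (h n - h m)) (h n - h m) < e].
Proof.
move=> hX M0 hf.
have [] := @riesz_sequence R H setT (fun x y => rd (X x) y) (rd f) M.
- by [].
- by [].
- by move=> x y; rewrite (res_sym hX) rdotC.
- by move=> a x y z; rewrite (res_lin hX) !rdotE.
- by move=> x _; exact: res_ge0.
- by move=> a x y; rewrite !rdotE.
- by [].
- by move=> x _; exact: hf.
move=> u [_ uC ul]; exists u; split; last first.
  move=> e /inv_succ_small [N hN]; exists N => n m Nn Nm.
  exact: le_lt_trans (uC _ _) (hN _ _ Nn Nm).
apply/cvgHP => e e0; have /cvg0P/(_ (e ^+ 2)) [|N hN] := inv_succ_cvg0 (R := R) 1.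
  by rewrite exprn_gt0.
exists N => n /hN; rewrite ger0_norm ?divr_ge0 //= => h1.
(* With r = X u_n - f as test vector, |r|^4 <= (X r, r) / (n + 1) <= |r|^2 / (n + 1). *)
have := ul n (X (u n) - f) I; rewrite -rdotNl -rdotDl -[- f]/(- f).
apply: contraTT; rewrite -ltNge -leNgt => h2.
have h3 : e ^+ 2 <= rd (X (u n) - f) (X (u n) - f).
  by rewrite -(rnorm_sqr (dot := dot)) ler_sqr ?nnegrE ?rnorm_ge0 //; exact: ltW.
apply: le_lt_trans (_ : rd (X (u n) - f) (X (u n) - f) / n.+1%:R < _).
  rewrite ler_wpM2r ?invr_ge0 //.
  pose proof (res_contr hX (X (u n) - f)) as h4.
  apply: le_trans (ler_norm _) _; apply: le_trans (rdot_CS _ _) _.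
  by rewrite -(rnorm_sqr (dot := dot)) expr2 ler_wpM2r // rnorm_ge0.
move: h1 h3; rewrite div1r; move: (rd _ _) (n.+1%:R^-1 : R) => a b h1 h3.
have e2 : 0 < e ^+ 2 by rewrite exprn_gt0.
by rewrite expr2 ltr_pM2l; lra.
Qed.

(* X and Y are the components of the resolvent of G^* G and of its composite
   with G: the hypothesis hG says that (X h, Y h) represents h on G. *)
Section GraphForm.
Variables (G : set (H * H)) (X Y : H -> H).
Hypothesis linG : linear_relation G.
Hypothesis mulG : forall g, G (0, g) -> g = 0.
Hypothesis hX : is_res X.
Hypothesis hXY : forall h, G (X h, Y h).
Hypothesis hG : forall h f, G f -> rd (X h) f.1 + rd (Y h) f.2 = rd h f.1.

Lemma graph_res_norm h : rd (X h) h = rd (X h) (X h) + rd (Y h) (Y h).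
Proof. by rewrite (hG h (hXY h)) rdotC. Qed.

Lemma graph_fun f g g' : G (f, g) -> G (f, g') -> g = g'.
Proof.
move=> h1 h2; have := linear_relB linG h1 h2; rewrite /= subrr => /mulG/eqP.
by rewrite subr_eq0 => /eqP.
Qed.

Lemma graph_resB h k : Y (h - k) = Y h - Y k.
Proof.
apply: graph_fun (hXY _) _; rewrite (resB hX).
exact: (linear_relB linG (hXY h) (hXY k)).
Qed.

Lemma graph_cauchy (h : nat -> H) :
  (forall e : R, 0 < e -> exists N, forall n m, (N <= n)%N -> (N <= m)%N ->
     rd (X (h n - h m)) (h n - h m) < e) -> cauchyH (Y \o h).
Proof.
move=> hC; apply: rdot_cauchyH => e /hC [N hN]; exists N => n m Nn Nm /=.
apply: le_lt_trans (hN n m Nn Nm).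
by rewrite graph_res_norm graph_resB lerDr rdot_ge0.
Qed.

Lemma graph_lim (h : nat -> H) f : (X \o h) @ \oo --> f ->
  (forall e : R, 0 < e -> exists N, forall n m, (N <= n)%N -> (N <= m)%N ->
     rd (X (h n - h m)) (h n - h m) < e) ->
  exists2 g, G (f, g) &
    (fun n => rd (X (h n)) (h n)) @ \oo --> rd g g + rd f f.
Proof.
move=> hf /graph_cauchy /cauchyH_cvg [g hg]; exists g.
  have [_ _ Gcl] := linG; apply: closed_lim Gcl _ hf hg => n; exact: hXY.
rewrite (_ : (fun n => _) =
    (fun n => rd (Y (h n)) (Y (h n)) + rd (X (h n)) (X (h n)))); last first.
  by apply/funext => n; rewrite graph_res_norm addrC.
by apply: cvgD; apply: cvg_rdot.
Qed.

(** Since (X h, h) = |X h|^2 + |Y h|^2, form-Cauchy sequences are those for which (X h_n, Y h_n)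
    converges in G. Conversely (f, k) = (X k, f) + (Y k, g), so Cauchy-Schwarz in H + H gives the
    bound that [riesz_res] requires. *)
Lemma graph_form f c : res_form X f c <-> exists2 g, G (f, g) & c = rd g g.
Proof.
split=> [[h [h1 h2 h3]]|[g Gfg ->]].
  have [g Gfg hg] := graph_lim h1 h2; exists g => //.
  by apply: (addIr (rd f f)); exact: cvgR_unique h3 hg.
have [|k|h [h1 h2]] := @riesz_res X f (rd f f + rd g g) hX.
- by rewrite addr_ge0 // rdot_ge0.
- apply: discriminant_le => [|t]; first exact: res_ge0.
  have := hG k Gfg; rewrite /= (rdotC k) => <-; rewrite graph_res_norm.
  pose proof (rdot_ge0 (t%:C *: X k + f)) as h1.
  pose proof (rdot_ge0 (t%:C *: Y k + g)) as h2; move: h1 h2.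
  by rewrite !rdotE (rdotC f (X k)) (rdotC g (Y k)) => h1 h2; lra.
exists h; split=> //.
have [g' Gfg' hg'] := graph_lim h1 h2.
by rewrite (graph_fun Gfg Gfg').
Qed.

End GraphForm.
End ClosedGraphs.
Arguments res_form {R H} dot X f c.

Section OperatorRoot.
Context {R : realType} {H : completeNormedModType R[i]}.
Context {dot : {dot H for (@Num.conj R[i])}} {dot_norm : inner_norm dot}.
Local Notation rd := (rdot dot).
Local Notation is_res := (is_resolvent dot).

(** * The closed form of a relation *)

Definition is_root (A T : set (H * H)) : Prop :=
  [/\ nonneg_selfadjoint_in dot (orth dot (mul_part A)) T,
      mul_part T = [set 0] & comp_rel T T = op_part dot A].

Variable X : H -> H.
Hypothesis hX : is_res X.
Let A := res_rel X.
Let M := orth dot (mul_part A).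

Lemma mul_resP m : mul_part A m <-> X m = 0.
Proof. by rewrite /A /mul_part /res_rel /= add0r. Qed.

Lemma mem_orthP x : M x <-> forall v, X v = 0 -> rd x v = 0.
Proof.
split=> h v; first by move=> /mul_resP /h; rewrite /rdot => ->.
move=> /mul_resP hv; rewrite (dotE (dot := dot)) !h //.
by rewrite (resZ hX) hv scaler0.
Qed.

Lemma orth0 : M 0.
Proof. by apply/mem_orthP => v _; rewrite rdot0l. Qed.

Lemma orth_lin a x y : M x -> M y -> M (a *: x + y).
Proof.
move=> hx hy v hv; rewrite linearDl linearZl_LR /=.
by rewrite (hx v hv) (hy v hv) mulr0 addr0.
Qed.

Lemma orthB x y : M x -> M y -> M (x - y).
Proof. by move=> hx hy; rewrite -scaleN1r addrC; exact: orth_lin. Qed.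

Lemma orth_closed (u : nat -> H) (l : H) : (forall n, M (u n)) -> u @ \oo --> l -> M l.
Proof.
move=> hu ul; apply/mem_orthP => v hv.
apply: (cvgR_eq _ (cvg_rdot ul (cvg_cst v)) (cvg_cst 0)) => n.
exact: (proj1 (mem_orthP _) (hu n)).
Qed.

Lemma orth_preserved (W : H -> H) : is_res W -> (forall x, W (X x) = X (W x)) ->
  forall x, M x -> M (W x).
Proof.
move=> hW WX x /mem_orthP hx; apply/mem_orthP => v hv.
by rewrite (res_sym hW) hx // -WX hv (res0 hW).
Qed.

(** m is h minus its projection onto ker X = mul A, obtained from [graph_projection] for ker X
    paired with 0. *)
Lemma orth_ker_decomp h : exists2 m, M m & X m = X h.
Proof.
pose G : set (H * H) := [set p | X p.1 = 0 /\ p.2 = 0].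
have linG : linear_relation G.
  split.
  - by rewrite /G /= (res0 hX).
  - by move=> a p q [h1 h2] [h3 h4]; split=> /=;
      rewrite ?(res_lin hX) ?h1 ?h2 ?h3 ?h4 scaler0 addr0.
  - apply: closed_seq => u v l m Guv ul vm; split=> /=.
      apply: (cvgH_eq _ (res_cvg hX ul) (cvg_cst 0)) => n.
      by have [] := Guv n.
    by apply: (cvgH_eq _ vm (cvg_cst 0)) => n; have [] := Guv n.
have [[k k'] [/= Xk _] hk] := graph_projection h linG.
exists (h - k); last by rewrite (resB hX) Xk subr0.
apply/mem_orthP => v hv; rewrite !rdotE.
have := hk (v, 0) (conj hv erefl); rewrite /= rdot0r addr0 => ->.
by rewrite subrr.
Qed.

(* With C = X^(1/2) and S = (I - X)^(1/2), the root of the operator part is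
   {(C w, S w) : w in M}, because that part is {(X k, (I - X) k) : k in M}. *)
Lemma root_exists : exists T, is_root A T.
Proof.
have hX' := res_compl hX.
have [C [hC CC Ccomm]] := resolvent_sqrt hX.
have [S [hS SS Scomm]] := resolvent_sqrt hX'.
(* The fourth root D of X serves nonnegativity only: (S w, C w) = (S D w, D w). *)
have [D [hD DD Dcomm]] := resolvent_sqrt hC.
have CX x : C (X x) = X (C x) by rewrite -!CC.
have SX x : S (X x) = X (S x).
  have h : S (x - X x) = S x - X (S x) by rewrite -!SS.
  by move: h; rewrite (resB hS) => /addrI /oppr_inj.
have SC x : S (C x) = C (S x).
  by apply: Ccomm => // ?; [exact: (res_lin hS) | exact: (res_contr hS)].
have SD x : S (D x) = D (S x).
  by apply: Dcomm => // ?; [exact: (res_lin hS) | exact: (res_contr hS)].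
have CM x : M x -> M (C x) by apply: orth_preserved.
have SM x : M x -> M (S x) by apply: orth_preserved.
(* Described by an equation instead of a parameter, so that closedness is immediate. *)
pose T : set (H * H) := [set p | [/\ M p.1, M p.2 & S p.1 = C p.2]].
have TP p : T p -> exists w, [/\ M w, p.1 = C w & p.2 = S w].
  (* Inverts w -> (C w, S w), since C^2 + S^2 = I. *)
  move=> [p1 p2 e]; exists (C p.1 + S p.2); split.
  - by rewrite -[C _]scale1r; apply: orth_lin; [exact: CM|exact: SM].
  - by rewrite (resD hC) CC -SC -e SS addrC subrK.
  - by rewrite (resD hS) SC e CC SS addrC subrK.
have CT w : M w -> T (C w, S w) by move=> Mw; split=> /=; [exact: CM|exact: SM|].
have T0 : T (0, 0) by split=> /=; rewrite ?(res0 hS) ?(res0 hC) //; exact: orth0.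
have TL (a : R[i]) (p q : H * H) : T p -> T q ->
        T (a *: p.1 + q.1, a *: p.2 + q.2).
  move=> [p1 p2 pe] [q1 q2 qe]; split=> /=; [exact: orth_lin|exact: orth_lin|].
  by rewrite (res_lin hS) (res_lin hC) pe qe.
have Tsym p q : T p -> T q -> rd p.2 q.1 = rd p.1 q.2.
  move=> /TP [w [_ -> ->]] /TP [v [_ -> ->]].
  by rewrite -(res_sym hC) -SC (res_sym hS).
exists T; split.
- split.
  + split=> //; apply: closed_seq => u v l m Tuv ul vm; split=> /=.
    * by apply: orth_closed ul => n; have [] := Tuv n.
    * by apply: orth_closed vm => n; have [] := Tuv n.
    * apply: (cvgH_eq _ (res_cvg hS ul) (res_cvg hC vm)) => n.
      by have [] := Tuv n.
  + apply/seteqP; split=> p.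
      move=> Tp; split; first by apply/(adjointP _ TL T0) => q Tq; exact: Tsym.
      by have [] := Tp.
    move=> [/(adjointP _ TL T0) h [p1 p2]]; split=> //.
    apply/eqP; rewrite -subr_eq0; apply/eqP/(rdot_eq0 (dot := dot)).
    (* Testing the adjoint relation against (C z, S z) for z = S p.1 - C p.2 yields (z, z) = 0. *)
    have Mz : M (S p.1 - C p.2) by apply: orthB; [exact: SM|exact: CM].
    have := h _ (CT _ Mz) => /=; rewrite (res_sym hS) (res_sym hC) => e.
    by rewrite rdotDr rdotNr e subrr.
  + apply/(nonneg_relP Tsym TL T0) => _ /TP [w [_ -> ->]].
    by rewrite -DD -(res_sym hD) -SD (res_ge0 hS).
- apply/seteqP; split=> m; last by move=> ->.
  move=> /TP [w [/mem_orthP Mw /= e ->]].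
  suff -> : w = 0 by rewrite (res0 hS).
  by apply: (rdot_eq0 (dot := dot)); apply: Mw; rewrite -CC -e (res0 hC).
- have MX k : M k -> M (X k) by apply: orth_preserved.
  apply/seteqP; split=> -[f f'] /=.
    move=> [g /TP [u [Mu /= fu gu]] /TP [v [Mv /= gv f'v]]].
    have [k [Mk /= uk vk]] := TP (u, v) (And3 Mu Mv (etrans (esym gu) gv)).
    rewrite fu uk CC f'v vk SS; split; first exact: res_relP.
    by split=> /=; [exact: MX | apply: orthB => //; exact: MX].
  move=> [Af [/= p1 p2]]; have Mk : M (f + f').
    by rewrite -[f]scale1r; exact: orth_lin.
  have f'E : f' = S (S (f + f')) by rewrite SS Af addrC addKr.
  exists (C (S (f + f'))); split=> //=.
  - by apply: CM; exact: SM.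
  - by rewrite CC -SX Af.
  - by apply: CM; exact: SM.
  - by rewrite {2}f'E SC.
Qed.

(** For h replaced by m in M with the same X m, the pair (X m, m - X m) is in T T, and Y h is the
    intermediate vector. The argument covers every root, so [closed_form] has the same value
    whichever root [xget] picks. *)
Lemma root_graph T : is_root A T ->
  [/\ linear_relation T, forall g, T (0, g) -> g = 0
    & exists Y : H -> H, (forall h, T (X h, Y h)) /\
        forall h f, T f -> rd (X h) f.1 + rd (Y h) f.2 = rd h f.1].
Proof.
move=> [[linT Tadj _] mulT TT]; have [T0 TL _] := linT.
have TM p : T p -> M p.1 by rewrite Tadj => -[_ []].
have Tsym p q : T p -> T q -> rd p.2 q.1 = rd p.1 q.2.
  by move=> Tp; rewrite Tadj => -[/(adjointP _ TL T0) h _]; exact: h.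
have /choice[Y hY] h : exists g, T (X h, g) /\
    forall f, T f -> rd (X h) f.1 + rd g f.2 = rd h f.1.
  have [m Mm Xm] := orth_ker_decomp h.
  have : op_part dot A (X m, m - X m).
    have MX : M (X m) by apply: orth_preserved.
    by split; [exact: res_relP | split=> //=; exact: orthB].
  rewrite -TT => -[g /= Tg Tg']; exists g; rewrite -Xm; split=> // f Tf.
  have /= <- := Tsym _ _ Tg' Tf; rewrite -rdotDl addrCA subrr addr0.
  have := proj1 (mem_orthP _) (TM _ Tf) (h - m).
  rewrite (resB hX) Xm subrr => /(_ erefl).
  by rewrite rdotC rdotDl rdotNl => /eqP; rewrite subr_eq0 => /eqP.
split=> // [g h|]; first by have : mul_part T g by []; rewrite mulT.
by exists Y; split=> h; have [] := hY h.
Qed.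

Lemma root_form T f c : is_root A T ->
  res_form dot X f c <-> exists2 u, T (f, u) & c = rd u u.
Proof. by move=> /root_graph [linT mulT [Y [hY hT]]]; exact: graph_form hY hT _ _. Qed.

Lemma root_closed_form T : is_root A T ->
  [set p | exists2 u, T (p.1, u) & p.2 = `|u| ^+ 2] =
  [set p : H * R[i] | exists2 c : R, res_form dot X p.1 c & p.2 = c%:C].
Proof.
move=> hT; have gf f c := root_form f c hT; apply/seteqP; split=> -[f c] /=.
  move=> [u Tu ->]; exists (rd u u); first by apply/gf; exists u.
  by rewrite rnormE -rmorphXn /= (rnorm_sqr (dot := dot)).
move=> [r /gf [u Tu ->] ->]; exists u => //.
by rewrite rnormE -rmorphXn /= (rnorm_sqr (dot := dot)).
Qed.

Lemma closed_form_res : closed_form dot A =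
  [set p : H * R[i] | exists2 c : R, res_form dot X p.1 c & p.2 = c%:C].
Proof.
have [T hT] := root_exists.
rewrite -(root_closed_form (T := sqrt_in dot M (op_part dot A))) //.
by rewrite /sqrt_in; apply: (xgetPex _ (P := [set T | is_root A T])); exists T.
Qed.

End OperatorRoot.

(** * Recovering a relation from its form *)

Section FormsOfResolvents.
Context {R : realType} {H : completeNormedModType R[i]}.
Context {dot : {dot H for (@Num.conj R[i])}} {dot_norm : inner_norm dot}.
Local Notation rd := (rdot dot).
Local Notation is_res := (is_resolvent dot).

Lemma res_form_fun X f c c' : is_res X ->
  res_form dot X f c -> res_form dot X f c' -> c = c'.
Proof.
move=> hX; have [T hT] := root_exists hX; have [linT mulT _] := root_graph hX hT.
move=> /(root_form hX _ _ hT)[u Tu ->] /(root_form hX _ _ hT)[v Tv ->].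
by rewrite (graph_fun linT mulT Tu Tv).
Qed.

Lemma res_form_dom_lin X a f g c d : is_res X ->
  res_form dot X f c -> res_form dot X g d -> exists r, res_form dot X (a *: f + g) r.
Proof.
move=> hX; have [T hT] := root_exists hX; have [[_ TL _] _ _] := root_graph hX hT.
move=> /(root_form hX _ _ hT)[u Tu _] /(root_form hX _ _ hT)[v Tv _].
exists (rd (a *: u + v) (a *: u + v)); apply/(root_form hX _ _ hT).
by exists (a *: u + v) => //; exact: (TL a _ _ Tu Tv).
Qed.

Lemma res_form_at X h : is_res X ->
  res_form dot X (X h) (rd (X h) h - rd (X h) (X h)).
Proof.
move=> hX; exists (fun=> h); split; [exact: cvg_cst| |].
  by move=> e e0; exists 0%N => n m _ _; rewrite subrr rdot0r.
by rewrite subrK; exact: cvg_cst.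
Qed.

(** The limit of (X (k_n - h), k_n - h) >= 0. Equality holds at f = X h ([res_form_at]), so (X h, h)
    is the supremum of the left side over the form domain. *)
Lemma res_form_le X f c h : is_res X -> res_form dot X f c ->
  2 * rd f h - (c + rd f f) <= rd (X h) h.
Proof.
move=> hX [k [k1 _ k2]].
have l1 : (fun n => 2 * rd (X (k n)) h - rd (X (k n)) (k n)) @ \oo -->
    2 * rd f h - (c + rd f f).
  apply: cvgB => //; apply: cvgM; first exact: cvg_cst.
  by apply: cvg_rdot => //; exact: cvg_cst.
apply: (ler_cvg_to l1 (cvg_cst (rd (X h) h))); apply: nearW => n.
pose proof (res_ge0 hX (k n - h)) as h1; move: h1.
rewrite (resB hX) !rdotE (rdotC (X h)) -(res_sym hX) => h1; lra.
Qed.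

(** Extending a form enlarges the set over which the supremum in [res_form_le] is taken. *)
Lemma res_form_mono X X' : is_res X -> is_res X' ->
  (forall f c, res_form dot X f c -> res_form dot X' f c) ->
  forall h, rd (X h) h <= rd (X' h) h.
Proof.
move=> hX hX' sub h; have := res_form_le h hX' (sub _ _ (res_form_at h hX)).
by lra.
Qed.

Lemma sym_eq0 (D : H -> H) : (forall a x y, D (a *: x + y) = a *: D x + D y) ->
  (forall x y, rd (D x) y = rd x (D y)) -> (forall x, rd (D x) x = 0) ->
  forall x, D x = 0.
Proof.
move=> DL Ds D0 x; apply: (@rdot_eqP _ _ dot) => y; rewrite rdot0l.
have := D0 (x + y); rewrite (linmapD DL) !rdotE !D0 (rdotC _ x) -Ds => h.
by lra.
Qed.

Lemma res_ext X X' : is_res X -> is_res X' ->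
  (forall h, rd (X h) h = rd (X' h) h) -> X = X'.
Proof.
move=> hX hX' h; apply/funext => x; apply/eqP; rewrite -subr_eq0; apply/eqP.
apply: (sym_eq0 (D := fun x => X x - X' x)) => [a y z|y z|y].
- by rewrite (res_lin hX) (res_lin hX') opprD addrACA -scalerBr.
- by rewrite !rdotE (res_sym hX) (res_sym hX').
- by rewrite !rdotE h subrr.
Qed.

Lemma nsa_closed_form_inj A B : nonneg_selfadjoint dot A -> nonneg_selfadjoint dot B ->
  closed_form dot A = closed_form dot B -> A = B.
Proof.
move=> /nsaP [X hX ->] /nsaP [X' hX' ->]; rewrite !closed_form_res // => e.
have sub Y Y' : [set p : H * R[i] | exists2 c : R, res_form dot Y p.1 c & p.2 = c%:C] =
    [set p : H * R[i] | exists2 c : R, res_form dot Y' p.1 c & p.2 = c%:C] ->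
    forall f c, res_form dot Y f c -> res_form dot Y' f c.
  move=> E f c hf; have : [set p : H * R[i] |
    exists2 c : R, res_form dot Y p.1 c & p.2 = c%:C] (f, c%:C) by exists c.
  by rewrite E => -[c' hc /complexI ->].
congr res_rel; apply: res_ext => // h; apply/eqP; rewrite eq_le.
by rewrite !res_form_mono //; apply: sub.
Qed.

Lemma rel_of_formE q A : nonneg_selfadjoint dot A -> closed_form dot A = q ->
  rel_of_form dot q = A.
Proof.
move=> nA cA; rewrite /rel_of_form; case: xgetP => [B -> [nB cB]|/(_ A)[]//].
by apply: nsa_closed_form_inj => //; rewrite cB.
Qed.

(* Real-valued counterpart of form_closure (form_of_rel S). *)
Definition rel_form (S : set (H * H)) (f : H) (c : R) : Prop :=
  exists p : nat -> H * H,
    [/\ forall n, S (p n), (fun n => (p n).1) @ \oo --> f,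
        forall e : R, 0 < e -> exists N, forall n m, (N <= n)%N -> (N <= m)%N ->
          rd ((p n).2 - (p m).2) ((p n).1 - (p m).1) < e
      & (fun n => rd (p n).2 (p n).1) @ \oo --> c].

Definition rel_form_graph S : set (H * R[i]) :=
  [set p | exists2 c : R, rel_form S p.1 c & p.2 = c%:C].

Lemma rel_form_sub S S' f c : S `<=` S' -> rel_form S f c -> rel_form S' f c.
Proof. by move=> sub [p [pS p1 p2 p3]]; exists p; split=> // n; exact: sub. Qed.

Lemma cvg_complex (r : nat -> R) (z : R[i]) :
  ((fun n => (r n)%:C) : nat -> R[i]^o) @ \oo --> (z : R[i]^o) <->
  exists2 c : R, r @ \oo --> c & z = c%:C.
Proof.
split=> [/cvgrPdist_lt h|[c rc ->]].
  have hz : complex.Im z = 0.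
    apply/eqP; rewrite -normr_le0 leNgt; apply/negP => i0.
    have : 0 < `|complex.Im z|%:C by rewrite ltcR.
    move=> /h [N _ /(_ N (leqnn N))] /= hlt.
    (* Multiplication by i turns the imaginary part of z into a real part, so |Im z| bounds the
       distance from z to every real number. *)
    have := normc_ge_Re ((z - (r N)%:C) * 'i).
    rewrite ReiNIm normrM (normc_def 'i) /= expr0n expr1n add0r sqrtr1 mulr1.
    by rewrite raddfB /= subr0 normrN => /le_lt_trans/(_ hlt); rewrite ltxx.
  have zE : z = (complex.Re z)%:C by case: z hz {h} => a b /= ->.
  exists (complex.Re z) => //; apply/cvgrPdist_lt => e e0.
  have : 0 < e%:C by rewrite ltcR.
  move=> /h [N _ hN]; exists N => // n /hN /=.
  by rewrite {1}zE -rmorphB /= normc_def /= expr0n addr0 sqrtr_sqr ltcR.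
apply/cvgrPdist_lt => e; rewrite ltcE /= => /andP[/eqP ei er].
have /cvgrPdist_lt/(_ _ er) [N _ hN] := rc; exists N => // n /hN /=.
by rewrite -rmorphB /= normc_def /= expr0n addr0 sqrtr_sqr ltcE /= ei eqxx.
Qed.

Lemma form_closureE S : linear_relation S -> symmetric_rel dot S -> nonneg_rel dot S ->
  form_closure (form_of_rel dot S) = rel_form_graph S.
Proof.
move=> linS symS posS; have [S0 SL _] := linS.
have val p : S p -> dot p.2 p.1 = (rd p.2 p.1)%:C.
  move=> /posS h; rewrite /rdot; move/ger0_Im: h.
  by case: (dot p.2 p.1) => a b /= ->.
(* The form of S is single-valued even if S is not: by symmetry (f', f) depends on f alone. *)
have vfun p q : S p -> S q -> p.1 = q.1 -> dot p.2 p.1 = dot q.2 q.1.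
  move=> Sp Sq e; have h1 := symS _ Sq _ Sp; have h2 := symS _ Sq _ Sq.
  by rewrite e h1 e -h2.
have real_part (a : R) : complex.Re a%:C = a by [].
apply/seteqP; split=> -[f z] /=.
  move=> [u [c [uc uf uC cz]]].
  have /choice[p hp] n : exists p, [/\ S p, p.1 = u n & dot p.2 p.1 = c n].
    by have [p Sp [<- <-]] := uc n; exists p.
  have cE : c = (fun n => (rd (p n).2 (p n).1)%:C).
    by apply/funext => n; have [Sp _ <-] := hp n; exact: val.
  move: cz; rewrite /= cE => /cvg_complex [r hr ->]; exists r => //.
  have pu : (fun n => (p n).1) = u by apply/funext => n; have [] := hp n.
  exists p; split=> //; [by move=> n; have [] := hp n | by rewrite pu|].
  move=> e e0; have [|N hN] := uC e%:C; first by rewrite ltcR.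
  exists N => n m Nn Nm; have [d [q Sq [q1 <-]] hd] := hN n m Nn Nm.
  have [Sn n1 _] := hp n; have [Sm m1 _] := hp m.
  have := vfun _ _ (linear_relB linS Sn Sm) Sq.
  rewrite /= n1 m1 => /(_ (esym q1)) e1.
  move: hd; rewrite q1 in e1 *; rewrite -e1 /rdot => h.
  apply: le_lt_trans (ler_norm _) _.
  by rewrite -ltcR; apply: le_lt_trans (normc_ge_Re _) h.
move=> [r [p [Sp pf pC pr]] /= ->].
exists (fun n => (p n).1), (fun n => (rd (p n).2 (p n).1)%:C); split=> //.
- by move=> n; exists (p n) => //; rewrite val.
- move=> e; rewrite ltcE /= => /andP[/eqP ei er].
  have [N hN] := pC _ er; exists N => n m Nn Nm.
  have Sd := linear_relB linS (Sp n) (Sp m).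
  exists (dot ((p n).2 - (p m).2) ((p n).1 - (p m).1)).
    by exists ((p n).1 - (p m).1, (p n).2 - (p m).2).
  have := val _ Sd => /= ->; rewrite normc_def /= expr0n addr0 sqrtr_sqr ltcE /= ei eqxx /=.
  have := posS _ Sd; rewrite lecE => /andP[_] /= h0.
  by rewrite ger0_norm //; exact: hN.
- by apply/cvg_complex; exists r.
Qed.

(** The substitution h = f + f', f = X h matches the two kinds of sequences, with (X h, h) = (f', f)
    + |f|^2. Hence the domain of a nonnegative selfadjoint relation is a core of its form. *)
Lemma rel_form_res X f c : is_res X ->
  rel_form (res_rel X) f c <-> res_form dot X f c.
Proof.
move=> hX; split.
  move=> [p [pX pf pC pc]]; exists (fun n => (p n).1 + (p n).2).
  have XE n : X ((p n).1 + (p n).2) = (p n).1 by exact: pX.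
  have eXp : X \o (fun n => (p n).1 + (p n).2) = (fun n => (p n).1).
    by apply/funext => n /=.
  split; first by rewrite eXp.
    move=> e e0; have [|N hN] := pC (e / 2); first lra.
    have [|N' hN'] := cvg_cauchyH pf (e := Num.sqrt (e / 2)).
      by rewrite sqrtr_gt0; lra.
    exists (maxn N N') => n m; rewrite !geq_max => /andP[n1 n2] /andP[m1 m2].
    rewrite (resB hX) !XE.
    have h1 := hN n m n1 m1; have h2 := hN' n m n2 m2.
    have h3 : rd ((p n).1 - (p m).1) ((p n).1 - (p m).1) < e / 2.
      rewrite -(rnorm_sqr (dot := dot)) -[ltRHS]sqr_sqrtr; last lra.
      by rewrite ltr_sqr // ?nnegrE ?rnorm_ge0 ?sqrtr_ge0.
    have -> : (p n).1 + (p n).2 - ((p m).1 + (p m).2) =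
      ((p n).1 - (p m).1) + ((p n).2 - (p m).2) by rewrite opprD addrACA.
    by rewrite rdotDr (rdotC _ ((p n).2 - _)); lra.
  rewrite (_ : (fun n => _) =
    (fun n => rd (p n).2 (p n).1 + rd (p n).1 (p n).1)); last first.
    by apply/funext => n; rewrite XE rdotDr addrC (rdotC (p n).1 (p n).2).
  by apply: cvgD => //; apply: cvg_rdot.
move=> [h [hf hC hc]]; exists (fun n => (X (h n), h n - X (h n))); split=> //=.
- by move=> n; exact: res_relP.
- move=> e /hC [N hN]; exists N => n m Nn Nm; apply: le_lt_trans (hN n m Nn Nm).
  have -> : h n - X (h n) - (h m - X (h m)) = (h n - h m) - X (h n - h m).
    by rewrite (resB hX) !opprB addrACA [RHS]addrACA (addrC (- h m)).
  rewrite -(resB hX) rdotDl rdotNl (rdotC _ (h n - h m)) gerBl; exact: rdot_ge0.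
- rewrite (_ : (fun n => _) =
    (fun n => rd (X (h n)) (h n) - rd (X (h n)) (X (h n)))); last first.
    by apply/funext => n; rewrite rdotDl rdotNl (rdotC (h n)).
  rewrite -[c](addrK (rd f f)); apply: cvgB => //; exact: cvg_rdot.
Qed.

Lemma closed_formE A : nonneg_selfadjoint dot A -> closed_form dot A = rel_form_graph A.
Proof.
move=> /nsaP [X hX ->]; rewrite closed_form_res //.
apply/seteqP; split=> -[f z]; rewrite /rel_form_graph /= => -[c hc ->];
  by exists c => //; apply/(rel_form_res _ _ hX).
Qed.

Lemma scale_relP (a : R) (A : set (H * H)) p : 0 < a ->
  scale_rel a%:C A p <-> A (p.1, (a^-1)%:C *: p.2).
Proof.
move=> a0; have an : a != 0 by rewrite gt_eqF.
split=> [[[f g] Afg <-] /=|Ap].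
  by rewrite scalerA -rmorphM /= mulVf // scale1r.
exists (p.1, (a^-1)%:C *: p.2) => //=.
by rewrite scalerA -rmorphM /= mulfV // scale1r -surjective_pairing.
Qed.

Lemma scale_nsa (a : R) A : 0 < a -> nonneg_selfadjoint dot A ->
  nonneg_selfadjoint dot (scale_rel a%:C A).
Proof.
move=> a0 [[A0 AL Acl]]; rewrite setXTT setIT => Aadj Apos.
have an : a != 0 by rewrite gt_eqF.
have aV : 0 < a^-1 by rewrite invr_gt0.
have Asym p q : A p -> A q -> rd p.2 q.1 = rd p.1 q.2.
  by move=> Ap; rewrite Aadj => /(adjointP _ AL A0); exact.
have Age0 p : A p -> 0 <= rd p.2 p.1.
  exact: (proj1 (nonneg_relP Asym AL A0) Apos).
have B0 : scale_rel a%:C A (0, 0) by apply/scale_relP; rewrite //= scaler0.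
have BL (b : R[i]) (p q : H * H) : scale_rel a%:C A p -> scale_rel a%:C A q ->
    scale_rel a%:C A (b *: p.1 + q.1, b *: p.2 + q.2).
  move=> /(scale_relP _ _ a0) Ap /(scale_relP _ _ a0) Aq; apply/scale_relP => //=.
  by rewrite scalerDr scalerA mulrC -scalerA; exact: (AL b _ _ Ap Aq).
have Bsym p q : scale_rel a%:C A p -> scale_rel a%:C A q -> rd p.2 q.1 = rd p.1 q.2.
  move=> [p' Ap <-] [q' Aq <-] /=.
  by rewrite rdotZl rdotZr (Asym _ _ Ap Aq).
split.
- split=> //; apply: closed_seq => u v l m Auv ul vm; apply/scale_relP => //=.
  apply: closed_lim Acl _ ul (cvgH_scale (c := (a^-1)%:C) vm) => n.
  by have /(scale_relP _ _ a0) := Auv n.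
- rewrite setXTT setIT; apply/seteqP; split=> p.
    by move=> Bp; apply/(adjointP _ BL B0) => q Bq; exact: Bsym.
  move=> /(adjointP _ BL B0) h; apply/scale_relP => //.
  rewrite Aadj; apply/(adjointP _ AL A0) => q Aq /=.
  have := h _ (ex_intro2 _ _ q Aq erefl); rewrite /= rdotZl rdotZr => <-.
  by rewrite mulrA mulVf // mul1r.
- apply/(nonneg_relP Bsym BL B0) => _ [p Ap <-] /=.
  by rewrite rdotZl; apply: mulr_ge0; [exact: ltW | exact: Age0].
Qed.

Lemma rel_form_scale (a : R) A f c : 0 < a -> rel_form A f c ->
  rel_form (scale_rel a%:C A) f (a * c).
Proof.
move=> a0 [p [Ap pf pC pc]]; exists (fun n => ((p n).1, a%:C *: (p n).2)); split=> //=.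
- by move=> n; exists (p n).
- move=> e e0; have [|N hN] := pC (e / a); first by rewrite divr_gt0.
  exists N => n m Nn Nm; rewrite -scalerBr rdotZl mulrC -ltr_pdivlMr //.
  exact: hN.
- rewrite (_ : (fun n => _) = (fun n => a * rd (p n).2 (p n).1)).
    by apply: cvgM => //; exact: cvg_cst.
  by apply/funext => n; rewrite rdotZl.
Qed.

Lemma scale_relK (a : R) (A : set (H * H)) : 0 < a ->
  scale_rel (a^-1)%:C (scale_rel a%:C A) = A.
Proof.
move=> a0; have an : a != 0 by rewrite gt_eqF.
apply/seteqP; split=> p.
  move=> /scale_relP; rewrite invr_gt0 invrK => /(_ a0) /scale_relP => /(_ a0) /=.
  by rewrite scalerA -rmorphM /= mulVf // scale1r -surjective_pairing.
move=> Ap; apply/scale_relP; first by rewrite invr_gt0.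
apply/scale_relP => //=.
by rewrite invrK scalerA -rmorphM /= mulVf // scale1r -surjective_pairing.
Qed.

End FormsOfResolvents.
Arguments rel_form {R H} dot S f c.
Arguments rel_form_graph {R H} dot S.

(** * The Friedrichs extension *)

Section Friedrichs.
Context {R : realType} {H : completeNormedModType R[i]}.
Context {dot : {dot H for (@Num.conj R[i])}} {dot_norm : inner_norm dot}.
Local Notation rd := (rdot dot).
Local Notation is_res := (is_resolvent dot).
Implicit Types S T : set (H * H).

Lemma rdotZ_conj (a : R[i]) x y : rd (a *: x) y = rd x (a^* *: y).
Proof.
rewrite (complex_scale a) (complex_scale a^*) !rdotE rdotil.
by case: a => u v /=; rewrite mulrN mulNr.
Qed.

Lemma closure_linear (A : set (H * H)) : A (0, 0) ->
  (forall (a : R[i]) (p q : H * H), A p -> A q -> A (a *: p.1 + q.1, a *: p.2 + q.2)) ->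
  linear_relation (closure A).
Proof.
move=> A0 AL; split; [exact: subset_closure | | exact: closed_closure].
move=> a p q /closure_seq [u [Au u1 u2]] /closure_seq [v [Av v1 v2]].
apply: (@closed_lim _ _ (closure A) (fun n => a *: (u n).1 + (v n).1)
  (fun n => a *: (u n).2 + (v n).2)) => [|n||].
- exact: closed_closure.
- by apply: subset_closure; exact: AL.
- exact: (cvgD (cvgH_scale (c := a) u1) v1).
- exact: (cvgD (cvgH_scale (c := a) u2) v2).
Qed.

(** X h and Y h are the components of the projection of (h, 0) onto G. The last clause is the
    uniqueness of that projection. *)
Lemma graph_resolvent (G : set (H * H)) : linear_relation G ->
  exists X Y : H -> H, [/\ is_res X, forall h, G (X h, Y h),
    forall h f, G f -> rd (X h) f.1 + rd (Y h) f.2 = rd h f.1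
  & forall h p, G p -> (forall q, G q -> rd p.1 q.1 + rd p.2 q.2 = rd h q.1) ->
      X h = p.1].
Proof.
move=> linG; have [G0 GL Gcl] := linG.
have /choice[P hP] h : exists p, G p /\
    forall q, G q -> rd p.1 q.1 + rd p.2 q.2 = rd h q.1.
  by have [p Gp hp] := graph_projection h linG; exists p.
have uniq h p : G p -> (forall q, G q -> rd p.1 q.1 + rd p.2 q.2 = rd h q.1) ->
    (P h).1 = p.1.
  have [GP hPh] := hP h => Gp hp.
  have Gd := linear_relB linG GP Gp.
  have := hp _ Gd; rewrite -hPh // => /eqP; rewrite -subr_eq0 => /eqP /= e.
  have e2 : rd ((P h).1 - p.1) ((P h).1 - p.1) + rd ((P h).2 - p.2) ((P h).2 - p.2) = 0.
    by move: e; rewrite !rdotE => e; lra.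
  apply/eqP; rewrite -subr_eq0; apply/eqP/(rdot_eq0 (dot := dot)).
  pose proof (rdot_ge0 ((P h).1 - p.1)) as h1.
  by pose proof (rdot_ge0 ((P h).2 - p.2)) as h2; lra.
exists (fun h => (P h).1), (fun h => (P h).2); split=> [|h|h f|//].
- split=> [a x y|x y|x].
  + have [Gx hx] := hP x; have [Gy hy] := hP y.
    apply: (uniq _ (_, _) (GL a _ _ Gx Gy)) => q Gq /=.
    have Gaq : G (a^* *: q.1, a^* *: q.2).
      by have := GL a^* _ _ Gq G0; rewrite /= !addr0.
    have := hx _ Gaq; have := hy _ Gq; rewrite /= -!rdotZ_conj !rdotDl => h1 h2.
    by lra.
  + have [Gx hx] := hP x; have [Gy hy] := hP y.
    by rewrite rdotC -hy // -hx // (rdotC (P y).1) (rdotC (P y).2).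
  + have [Gx hx] := hP x; have := hx _ Gx; rewrite (rdotC x).
    by pose proof (rdot_ge0 (P x).2) as h1; move=> h2; lra.
- by rewrite -surjective_pairing; have [] := hP h.
- by have [_] := hP h; exact.
Qed.

(* The given extension T spares an abstract completion: the form of S is
   |Q f|^2 for the root Q of T, so its closure comes from the closure of the
   restriction of Q to the domain of S. *)
Lemma friedrichs_exists S T : linear_relation S -> symmetric_rel dot S ->
  nonneg_rel dot S -> nonneg_selfadjoint_ext dot S T ->
  exists X, [/\ is_res X, friedrichs dot S = res_rel X, S `<=` res_rel X
    & forall f c, rel_form dot S f c <-> res_form dot X f c].
Proof.
move=> linS symS posS [/nsaP [XT hXT ->] ST]; have [S0 SL Scl] := linS.
have [Q hQ] := root_exists hXT.
have [linQ mulQ [Y [QY hY]]] := root_graph hXT hQ.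
(* For p in S, [XT] sends p.1 + p.2 to p.1, so U p is the value of Q at p.1. *)
pose U (p : H * H) := Y (p.1 + p.2).
have QU p : S p -> Q (p.1, U p) by move=> Sp; rewrite -{1}(ST _ Sp); exact: QY.
have hU p f : S p -> Q f -> rd p.1 f.1 + rd (U p) f.2 = rd (p.1 + p.2) f.1.
  by move=> Sp Qf; rewrite -{1}(ST _ Sp) hY.
have UU p : S p -> rd (U p) (U p) = rd p.2 p.1.
  move=> Sp; have := hU _ _ Sp (QU _ Sp); rewrite /= rdotDl => h.
  by lra.
have UL a p q : U (a *: p.1 + q.1, a *: p.2 + q.2) = a *: U p + U q.
  have [_ QL _] := linQ.
  apply: (graph_fun linQ mulQ (QY _)); have := QL a _ _ (QY (p.1 + p.2)) (QY (q.1 + q.2)).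
  by rewrite /= -(res_lin hXT) scalerDr addrACA.
have UB p q : U (p.1 - q.1, p.2 - q.2) = U p - U q.
  by have := UL (-1) q p; rewrite !scaleN1r ![- _ + _]addrC.
pose G0 : set (H * H) := [set (p.1, U p) | p in S].
have G0Q : G0 `<=` Q by move=> _ [p Sp <-]; exact: QU.
have linG : linear_relation (closure G0).
  apply: closure_linear.
    exists (0, 0) => //; congr (_, _); rewrite /U /= addr0.
    by apply: mulQ; rewrite -[X in Q (X, _)](res0 hXT).
  move=> a _ _ [p Sp <-] [q Sq <-].
  by exists (a *: p.1 + q.1, a *: p.2 + q.2); [exact: SL | rewrite UL].
have GQ : closure G0 `<=` Q.
  move=> p /closure_seq [u [Gu u1 u2]]; rewrite (surjective_pairing p).
  have [_ _ Qcl] := linQ; apply: closed_lim Qcl _ u1 u2 => n.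
  by rewrite -surjective_pairing; exact: G0Q.
have mulG g : closure G0 (0, g) -> g = 0 by move=> /GQ; exact: mulQ.
have [X [Z [hX GX hZ uniq]]] := graph_resolvent linG.
(* (p.1, U p) satisfies the normal equation for p.1 + p.2 against all of Q, hence against the
   smaller graph. *)
have SX : S `<=` res_rel X.
  move=> p Sp; apply: (uniq _ (p.1, U p)).
    by apply: subset_closure; exists p.
  by move=> q /GQ Qq; exact: (hU p q Sp Qq).
have formE f c : rel_form dot S f c <-> res_form dot X f c.
  rewrite (graph_form linG mulG hX GX hZ); split.
    move=> [p [Sp pf pC pc]].
    have cU : cauchyH (fun n => U (p n)).
      apply: rdot_cauchyH => e /pC [N hN]; exists N => n m Nn Nm.
      have := UU _ (linear_relB linS (Sp n) (Sp m)); rewrite UB /= => ->.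
      exact: hN.
    have [g hg] := cauchyH_cvg cU; exists g.
      apply: (@closed_lim _ _ (closure G0)) pf hg; first exact: closed_closure.
      by move=> n; apply: subset_closure; exists (p n).
    apply: (cvgR_eq _ pc (cvg_rdot hg hg)) => n.
    by rewrite UU.
  move=> [g /closure_seq [u [Gu /= u1 u2]] ->].
  have /choice[p hp] n : exists p, [/\ S p, p.1 = (u n).1 & U p = (u n).2].
    by have [p Sp <-] := Gu n; exists p.
  have p1 : (fun n => (p n).1) = (fun n => (u n).1).
    by apply/funext => n; have [] := hp n.
  have p2 n : U (p n) = (u n).2 by have [] := hp n.
  have Sp n : S (p n) by have [] := hp n.
  exists p; split=> //; first by rewrite p1.
    move=> e e0; have [|N hN] := cvg_cauchyH u2 (e := Num.sqrt e).
      by rewrite sqrtr_gt0.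
    exists N => n m Nn Nm; have := UU _ (linear_relB linS (Sp n) (Sp m)).
    rewrite UB /= => <-; rewrite -(rnorm_sqr (dot := dot)) !p2 -[ltRHS]sqr_sqrtr ?ltW //.
    by rewrite ltr_sqr // ?nnegrE ?rnorm_ge0 ?sqrtr_ge0 //; exact: hN.
  rewrite (_ : (fun n => _) = (fun n => rd (u n).2 (u n).2)); first exact: cvg_rdot.
  by apply/funext => n; rewrite -UU // p2.
exists X; split=> //; rewrite /friedrichs form_closureE //.
apply: rel_of_formE; first exact: nsa_res_rel.
rewrite closed_form_res //; apply/seteqP; split=> -[f z]; rewrite /rel_form_graph /=;
  by move=> -[c hc ->]; exists c => //; apply/formE.
Qed.

Lemma inv_linear S : linear_relation S -> linear_relation (inv_rel S).
Proof.
move=> [S0 SL Scl]; split=> //.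
  by move=> a p q Sp Sq; exact: (SL a _ _ Sp Sq).
by apply: closed_seq => u v l m Suv ul vm; exact: closed_lim Scl Suv vm ul.
Qed.

Lemma inv_symmetric S : symmetric_rel dot S -> symmetric_rel dot (inv_rel S).
Proof.
move=> symS p Sp q Sq; have /= h := symS _ Sp _ Sq.
by rewrite h.
Qed.

Lemma inv_nonneg S : nonneg_rel dot S -> nonneg_rel dot (inv_rel S).
Proof.
move=> posS p Sp; have /= := posS _ Sp.
by rewrite (dot_conj (dot := dot) p.2) conj_ge0.
Qed.

Lemma inv_ext S T : nonneg_selfadjoint_ext dot S T ->
  nonneg_selfadjoint_ext dot (inv_rel S) (inv_rel T).
Proof.
move=> [/nsaP [X hX ->] ST]; split; last by move=> p /ST.
by rewrite inv_res_rel; apply: nsa_res_rel; exact: res_compl.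
Qed.

Lemma inv_relK S : inv_rel (inv_rel S) = S.
Proof. by apply/seteqP; split=> -[]. Qed.

(** f is approximated in the form by elements p_n of S. By symmetry (f' - p_n', f - p_n) = (f', f) +
    (p_n', p_n) - 2 Re (f', p_n), which tends to 0. *)
Lemma extremal_friedrichs S X : is_res X -> S `<=` res_rel X ->
  (forall f c, rel_form dot S f c <-> res_form dot X f c) ->
  extremal dot S (res_rel X).
Proof.
move=> hX SX formE; split; first by split=> //; exact: nsa_res_rel.
move=> f Xf.
have := res_form_at (f.1 + f.2) hX; rewrite Xf => /formE [p [Sp pf _ pc]].
have val g : complex.Re (dot (f.2 - g.2) (f.1 - g.1)) = rd (f.2 - g.2) (f.1 - g.1) by [].
have lbB g : S g -> 0 <= rd (f.2 - g.2) (f.1 - g.1).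
  have [linX _ _] := nsa_res_rel hX => /SX Xg.
  exact: (res_rel_ge0 hX (linear_relB linX Xf Xg)).
have lim0 : (fun n => rd (f.2 - (p n).2) (f.1 - (p n).1)) @ \oo --> (0 : R).
  rewrite (_ : (fun n => _) = (fun n =>
      rd f.2 f.1 + rd (p n).2 (p n).1 - 2 * rd f.2 (p n).1)); last first.
    apply/funext => n; have := res_rel_sym hX (SX _ (Sp n)) Xf.
    by rewrite !rdotE (rdotC (p n).1) => ->; ring.
  rewrite (_ : 0 = rd f.2 f.1 + (rd f.1 (f.1 + f.2) - rd f.1 f.1) - 2 * rd f.2 f.1);
    last by rewrite rdotDr (rdotC f.1 f.2); ring.
  apply: cvgB; first by apply: cvgD => //; exact: cvg_cst.
  by apply: cvgM; [exact: cvg_cst | apply: cvg_rdot => //; exact: cvg_cst].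
set B := [set _ | g in S].
have Bn n : B (rd (f.2 - (p n).2) (f.1 - (p n).1)) by exists (p n).
have B0 : lbound B 0 by move=> _ [g Sg <-]; exact: lbB.
apply/eqP; rewrite eq_le; apply/andP; split; last first.
  by apply: lb_le_inf => //; exists (rd (f.2 - (p 0%N).2) (f.1 - (p 0%N).1)).
apply: (ler_cvg_to (cvg_cst (inf B)) lim0); apply: nearW => n.
by apply: ge_inf => //; exists 0.
Qed.

Lemma extremal_inv S T : extremal dot (inv_rel S) (inv_rel T) -> extremal dot S T.
Proof.
move=> [/inv_ext]; rewrite !inv_relK => extT h; split=> // -[f f'] Tf.
have /= <- := h (f', f) Tf; congr (inf _).
by apply/seteqP; split=> _ [[g g'] Sg <-]; exists (g', g) => //; exact: rdotC.
Qed.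

(* e is form-orthogonal to the domain of S, which is a core. *)
Lemma orth_range_form S e c : linear_relation S -> symmetric_rel dot S ->
  nonneg_rel dot S -> (forall p, S p -> rd (p.1 + p.2) e = 0) ->
  rel_form dot S e c -> e = 0.
Proof.
move=> linS symS posS he [p [Sp pe pC pc]].
have c0 : 0 <= c.
  apply: (ler_cvg_to (cvg_cst 0) pc); apply: nearW => n.
  by have := posS _ (Sp n); rewrite lecE => /andP[].
pose proof (rdot_ge0 e) as e0.
apply: (rdot_eq0 (dot := dot)); apply/eqP; rewrite eq_le e0 andbT leNgt.
(* The form of p_n - p_m, first as m and then as n grows, tends to 2 c + 2 |e|^2 because (p_n', e) =
   - (p_n, e). The tolerance c + |e|^2 is half of that. *)
apply/negP => epos; have [|N hN] := pC (c + rd e e); first lra.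
suff : 2 * c + 2 * rd e e <= c + rd e e by move=> h; lra.
have stage n : (N <= n)%N -> rd (p n).2 (p n).1 + c + 2 * rd (p n).1 e <= c + rd e e.
  move=> Nn.
  have l1 : (fun m => rd ((p n).2 - (p m).2) ((p n).1 - (p m).1)) @ \oo -->
      rd (p n).2 (p n).1 + c - 2 * rd (p n).2 e.
    rewrite (_ : (fun m => _) = (fun m =>
      rd (p n).2 (p n).1 + rd (p m).2 (p m).1 - 2 * rd (p n).2 (p m).1)); last first.
      apply/funext => m.
      have : rd (p m).2 (p n).1 = rd (p m).1 (p n).2.
        by rewrite /rdot (symS _ (Sp n) _ (Sp m)).
      by rewrite !rdotE (rdotC (p m).1) => ->; ring.
    apply: cvgB; first by apply: cvgD => //; exact: cvg_cst.
    by apply: cvgM; [exact: cvg_cst | apply: cvg_rdot => //; exact: cvg_cst].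
  have l2 : rd (p n).2 (p n).1 + c - 2 * rd (p n).2 e <= c + rd e e.
    apply: (ler_cvg_to l1 (cvg_cst _)); exists N => // m Nm; apply: ltW; exact: hN.
  by have := he _ (Sp n); rewrite rdotDl => h; lra.
have l3 : (fun n => rd (p n).2 (p n).1 + c + 2 * rd (p n).1 e) @ \oo -->
    c + c + 2 * rd e e.
  apply: cvgD; first by apply: cvgD => //; exact: cvg_cst.
  by apply: cvgM; [exact: cvg_cst | apply: cvg_rdot => //; exact: cvg_cst].
have -> : 2 * c + 2 * rd e e = c + c + 2 * rd e e by ring.
by apply: (ler_cvg_to l3 (cvg_cst _)); exists N.
Qed.

End Friedrichs.

(** * Extensions differing by a rank one resolvent *)

(* The value 0 / 0 = 0 at a = b = 0 is the intended one: t = 0 is the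
   Friedrichs extension. *)
Definition mean2 (R : realType) (a b : R) : R := 2 * a * b / (a + b).

Section Pencil.
Context {R : realType} {H : completeNormedModType R[i]}.
Context {dot : {dot H for (@Num.conj R[i])}} {dot_norm : inner_norm dot}.
Local Notation rd := (rdot dot).
Local Notation is_res := (is_resolvent dot).

Lemma res_form_ge0 X f c : is_res X -> res_form dot X f c -> 0 <= c.
Proof.
move=> hX; have [T hT] := root_exists hX.
by move=> /(root_form hX _ _ hT)[u _ ->]; exact: rdot_ge0.
Qed.

Lemma riesz_dom X f (M : R) : is_res X -> 0 <= M ->
  (forall k, rd f k ^+ 2 <= M * rd (X k) k) -> exists c, res_form dot X f c.
Proof.
move=> hX M0 /(riesz_res hX M0) [h [h1 h2]].
have [T hT] := root_exists hX; have [linT mulT [Y [TY hY]]] := root_graph hX hT.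
have [g _ hg] := graph_lim linT mulT hX TY hY h1 h2.
by exists (rd g g), h.
Qed.

Variables (X0 : H -> H) (e : H).

Definition rank1 (x : H) : H := dot x e *: e.
Definition pencil (t : R) (x : H) : H := X0 x + t%:C *: rank1 x.

Lemma rank1_lin a x y : rank1 (a *: x + y) = a *: rank1 x + rank1 y.
Proof. by rewrite /rank1 linearDl linearZl_LR /= scalerDl scalerA. Qed.

Lemma rank1E x : rank1 x = (rd x e)%:C *: e + (rd x ('i *: e))%:C *: ('i *: e).
Proof.
by rewrite /rank1 {1}(dotE (dot := dot) x e) (complex_scale (_ +i* _)).
Qed.

Lemma rank1_sym x y : rd (rank1 x) y = rd x (rank1 y).
Proof.
by rewrite !rank1E !rdotE (rdotC e y) (rdotC ('i *: e) y); ring.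
Qed.

Lemma rank1_form x : rd (rank1 x) x = rd x e ^+ 2 + rd x ('i *: e) ^+ 2.
Proof. by rewrite rank1E !rdotE (rdotC e) (rdotC ('i *: e)); ring. Qed.

Lemma rank1_ge0 x : 0 <= rd (rank1 x) x.
Proof. by rewrite rank1_form addr_ge0 // sqr_ge0. Qed.

Lemma pencil0 : pencil 0 = X0.
Proof. by apply/funext => x; rewrite /pencil scale0r addr0. Qed.

Hypothesis hX0 : is_res X0.
Hypothesis hX1 : is_res (pencil 1).

Lemma pencilE t x : rd (pencil t x) x = rd (X0 x) x + t * rd (rank1 x) x.
Proof. by rewrite /pencil !rdotE. Qed.

Lemma pencil_res t : 0 <= t <= 1 -> is_res (pencil t).
Proof.
move=> /andP[t0 t1]; apply: positive_resolvent => [a x y|x y|x].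
- by rewrite /pencil (res_lin hX0) rank1_lin scalerDr addrACA scalerDr !scalerA
    [_ * a]mulrC.
- by rewrite /pencil !rdotE (res_sym hX0) rank1_sym.
- have h1 := rank1_ge0 x; pose proof (res_ge0 hX0 x) as h0.
  pose proof (res_ge0 (res_compl hX1) x) as h2; move: h2.
  rewrite rdotDl rdotNl !pencilE => h2; apply/andP; split.
    by rewrite addr_ge0 // mulr_ge0.
  have : t * rd (rank1 x) x <= 1 * rd (rank1 x) x by exact: ler_wpM2r.
  by lra.
Qed.

Hypothesis e_dom : forall c, ~ res_form dot X0 e c.

Let e_neq0 : rd e e != 0.
Proof.
apply/negP => /eqP /(rdot_eq0 (dot := dot)) e0.
apply: (e_dom (c := rd (X0 0) 0 - rd (X0 0) (X0 0))).
by pose proof (res_form_at 0 hX0) as h; rewrite {1}(res0 hX0) in h; rewrite e0.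
Qed.

Let eie : rd e ('i *: e) = 0.
Proof. by have := rdotil (dot := dot) e e; rewrite rdotC => h; lra. Qed.

Definition csqr (a : R[i]) : R := complex.Re a ^+ 2 + complex.Im a ^+ 2.

(** Both summands of (X_t h, h) are nonnegative, so a form-Cauchy sequence for X_t is one for X_0.
    Hence X_0 h_n --> f0, and (h_n, e) e converges to (f - f0) / t, a multiple of e. *)
Lemma pencil_decomp t f c : 0 < t <= 1 -> res_form dot (pencil t) f c ->
  exists f0 a c0, [/\ f = f0 + a *: e, res_form dot X0 f0 c0
    & c + rd f f = c0 + rd f0 f0 + csqr a / t].
Proof.
move=> /andP[t0 t1] [h [hf hC hc]]; have tn : t != 0 by rewrite gt_eqF.
have C0 (d : R) : 0 < d -> exists N, forall n m, (N <= n)%N -> (N <= m)%N ->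
    rd (X0 (h n - h m)) (h n - h m) < d.
  move=> /hC [N hN]; exists N => n m Nn Nm; apply: le_lt_trans (hN n m Nn Nm).
  by rewrite pencilE lerDl mulr_ge0 // ?rank1_ge0 // ltW.
have /cauchyH_cvg [f0 hf0] : cauchyH (X0 \o h).
  apply: rdot_cauchyH => d /C0 [N hN]; exists N => n m Nn Nm /=.
  rewrite -(resB hX0); apply: le_lt_trans (res_firm hX0 _) _; exact: hN.
pose g := (t^-1)%:C *: (f - f0).
have hg : (fun n => rank1 (h n)) @ \oo --> g.
  rewrite (_ : (fun n => _) = (fun n => (t^-1)%:C *: (pencil t (h n) - X0 (h n)))).
    exact: (cvgH_scale (c := (t^-1)%:C) (cvgB hf hf0)).
  apply/funext => n; rewrite /pencil addrAC subrr add0r scalerA -rmorphM /=.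
  by rewrite mulVf // scale1r.
have hr : (fun n => rd (h n) e) @ \oo --> rd g e / rd e e.
  rewrite (_ : (fun n => _) = (fun n => rd (rank1 (h n)) e / rd e e)).
    exact: (cvgM (cvg_rdot hg (cvg_cst _)) (cvg_cst _)).
  apply/funext => n; rewrite rank1E !rdotE (rdotC ('i *: e) e) eie mulr0 addr0.
  by rewrite mulfK.
have hs : (fun n => rd (h n) ('i *: e)) @ \oo --> rd g ('i *: e) / rd e e.
  rewrite (_ : (fun n => _) = (fun n => rd (rank1 (h n)) ('i *: e) / rd e e)).
    exact: (cvgM (cvg_rdot hg (cvg_cst _)) (cvg_cst _)).
  apply/funext => n; rewrite rank1E !rdotE rdotii eie mulr0 add0r.
  by rewrite mulfK.
move: hr hs; set r := _ / _; set s := (X in _ -> X -> _) => hr.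
rewrite {}/s; set s := _ / _ => hs.
have gE : g = r%:C *: e + s%:C *: ('i *: e).
  apply: (cvgH_eq (fun n => rank1E (h n)) hg).
  have cv (u : nat -> R) (l : R) (v : H) : u @ \oo --> l ->
      (fun n => (u n)%:C *: v) @ \oo --> l%:C *: v.
    move=> ul; apply: (@cvgZ R[i] H _ _ _ (fun n => (u n)%:C)); last exact: cvg_cst.
    by apply/cvg_complex; exists l.
  by apply: cvgD; exact: cv.
have hw : (fun n => rd (rank1 (h n)) (h n)) @ \oo --> r ^+ 2 + s ^+ 2.
  rewrite (_ : (fun n => _) = (fun n => rd (h n) e * rd (h n) e +
      rd (h n) ('i *: e) * rd (h n) ('i *: e))).
    by rewrite !expr2; apply: cvgD; apply: cvgM.
  by apply/funext => n; rewrite rank1_form !expr2.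
(* r + i s is the limit of (h_n, e), so a is t times it and t (r^2 + s^2) = |a|^2 / t. *)
exists f0, (t%:C * (r +i* s)), (c + rd f f - t * (r ^+ 2 + s ^+ 2) - rd f0 f0); split.
- rewrite -scalerA (complex_scale (r +i* s)) /= -gE /g scalerA -rmorphM /= mulfV // scale1r.
  by rewrite addrC subrK.
- exists h; split=> //; rewrite subrK.
  rewrite (_ : (fun n => _) =
    (fun n => rd (pencil t (h n)) (h n) - t * rd (rank1 (h n)) (h n))).
    by apply: cvgB => //; apply: cvgM => //; exact: cvg_cst.
  by apply/funext => n; rewrite pencilE addrK.
- by rewrite subrK /csqr /= !mul0r subr0 addr0; field.
Qed.

Lemma decomp_unique f g a b c d : res_form dot X0 f c -> res_form dot X0 g d ->
  f + a *: e = g + b *: e -> a = b /\ f = g.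
Proof.
move=> hf hg E; have ab : a = b.
  apply/eqP; rewrite -subr_eq0; apply/negP => /negP ab0.
  have [r hr] := res_form_dom_lin (-1) hX0 hf hg.
  have [r0 hr0] : exists c, res_form dot X0 0 c.
    pose proof (res_form_at 0 hX0) as h0; rewrite {1}(res0 hX0) in h0.
    by exists (rd (X0 0) 0 - rd (X0 0) (X0 0)).
  have [r' hr'] := res_form_dom_lin (a - b)^-1 hX0 hr hr0.
  apply: (e_dom (c := r')); move: hr'; congr (res_form dot X0 _ _).
  have -> : -1 *: f + g = (a - b) *: e.
    have Ea : a *: e = g + b *: e - f by rewrite -E addrAC subrr add0r.
    by rewrite scaleN1r scalerBl Ea addrAC addrK addrC.
  by rewrite addr0 scalerA mulVf // scale1r.
by split=> //; move: E; rewrite ab => /addIr.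
Qed.

(* Riesz only gives some value of the form at f0 + a e; pencil_decomp and the
   uniqueness of the decomposition then identify it. *)
Lemma pencil_formP t f0 a c0 : 0 < t <= 1 -> res_form dot X0 f0 c0 ->
  res_form dot (pencil t) (f0 + a *: e)
    (c0 + rd f0 f0 + csqr a / t - rd (f0 + a *: e) (f0 + a *: e)).
Proof.
move=> ht hf; have /andP[t0 t1] := ht.
have hXt : is_res (pencil t) by apply: pencil_res; rewrite ltW.
have cs0 : 0 <= csqr a by rewrite addr_ge0 // sqr_ge0.
have M0 : 0 <= c0 + rd f0 f0.
  by rewrite addr_ge0 ?rdot_ge0 // (res_form_ge0 hX0 hf).
have [|k|c hc] := @riesz_dom (pencil t) (f0 + a *: e) (c0 + rd f0 f0 + csqr a / t) hXt.
- by rewrite addr_ge0 // divr_ge0 // ltW.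
- apply: discriminant_le => [|x]; first exact: res_ge0.
  pose proof (res_form_le ((- x)%:C *: k) hX0 hf) as b1; move: b1.
  rewrite pencilE rank1_form (complex_scale a) (resZ hX0) !rdotE (rdotC e k).
  rewrite (rdotC ('i *: e) k) /csqr => b1.
  move: (rd k e) (rd k ('i *: e)) (complex.Re a) (complex.Im a) => p q u v.
  (* [b1] accounts for f0; this square, |a + x t (k, e)|^2 / t, accounts for the component a e. *)
  have : 0 <= ((u + x * t * p) ^+ 2 + (v + x * t * q) ^+ 2) / t.
    by rewrite divr_ge0 ?addr_ge0 ?sqr_ge0 // ltW.
  have -> : ((u + x * t * p) ^+ 2 + (v + x * t * q) ^+ 2) / t =
    (u ^+ 2 + v ^+ 2) / t + 2 * x * (u * p + v * q) + x ^+ 2 * (t * (p ^+ 2 + q ^+ 2)).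
    by field; rewrite gt_eqF.
  by move=> h; lra.
have [f1 [b [c1 [E hf1 Ec]]]] := pencil_decomp ht hc.
have [ab ff] := decomp_unique hf hf1 E.
rewrite -ff in hf1 Ec; rewrite -ab in Ec.
rewrite -(res_form_fun hX0 hf hf1) in Ec.
by rewrite -Ec addrK.
Qed.

Lemma pencil_form_base t f c : 0 <= t <= 1 -> res_form dot X0 f c ->
  res_form dot (pencil t) f c.
Proof.
move=> /andP[t0 t1] hf; have [->|tn] := eqVneq t 0; first by rewrite pencil0.
have := pencil_formP 0 (t := t) _ hf; rewrite scale0r addr0 /csqr /= expr0n addr0 mul0r.
by rewrite addr0 addrK; apply; rewrite lt0r tn t0.
Qed.

Lemma mean2_itv (a b : R) : 0 <= a <= 1 -> 0 <= b <= 1 -> 0 <= mean2 a b <= 1.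
Proof.
move=> /andP[a0 a1] /andP[b0 b1]; rewrite /mean2.
have [ab|ab] := eqVneq (a + b) 0; first by rewrite ab invr0 mulr0 lexx ler01.
have abp : 0 < a + b by rewrite lt0r ab addr_ge0.
rewrite divr_ge0 ?mulr_ge0 ?addr_ge0 //= ler_pdivrMr // mul1r; nra.
Qed.

Lemma pencil_form_add a b f c : 0 <= a <= 1 -> 0 <= b <= 1 ->
  res_form dot (pencil (mean2 a b)) f c <->
  exists c1 c2, [/\ res_form dot (pencil a) f c1, res_form dot (pencil b) f c2
    & 2 * c = c1 + c2].
Proof.
move=> ha hb; have /andP[a0 a1] := ha; have /andP[b0 b1] := hb.
(* For a = 0 the mean is 0: the sum lives on the form domain of [X0], where the form of [pencil b]
   agrees with that of [X0]. *)
have [az|an] := eqVneq a 0.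
  rewrite az /mean2 mulr0 !mul0r pencil0; split=> [h|[c1 [c2 [h1 h2 E]]]].
    by exists c, c; split=> //; [exact: pencil_form_base | ring].
  pose proof (pencil_form_base hb h1) as h3.
  pose proof (res_form_fun (pencil_res hb) h2 h3) as E2.
  by have -> : c = c1 by rewrite E2 in E; lra.
have [bz|bn] := eqVneq b 0.
  rewrite bz /mean2 mulr0 !mul0r pencil0; split=> [h|[c1 [c2 [h1 h2 E]]]].
    by exists c, c; split=> //; [exact: pencil_form_base | ring].
  pose proof (pencil_form_base ha h2) as h3.
  pose proof (res_form_fun (pencil_res ha) h1 h3) as E2.
  by have -> : c = c2 by rewrite E2 in E; lra.
have ap : 0 < a by rewrite lt0r an.
have bp : 0 < b by rewrite lt0r bn.
have ha' : 0 < a <= 1 by rewrite ap.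
have hb' : 0 < b <= 1 by rewrite bp.
have hm : 0 < mean2 a b <= 1.
  have /andP[_ ->] := mean2_itv ha hb; rewrite andbT.
  by rewrite divr_gt0 ?addr_gt0 // !mulr_gt0.
have abn : a + b != 0 by rewrite gt_eqF // addr_gt0.
have sumE x : x / a + x / b = 2 * (x / mean2 a b).
  by rewrite /mean2; field; rewrite an bn abn.
split=> [h|[c1 [c2 [h1 h2 E]]]].
  have [f0 [z [c0 [-> hf0 Ec]]]] := pencil_decomp hm h.
  eexists; eexists; split; [exact: pencil_formP hf0 | exact: pencil_formP hf0|].
  by have E := sumE (csqr z); lra.
have [f0 [z [c0 [E1 hf0 Ec1]]]] := pencil_decomp ha' h1.
have [f1 [z' [c1' [E1' hf1 Ec2]]]] := pencil_decomp hb' h2.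
have [zz ff] := decomp_unique hf0 hf1 (etrans (esym E1) E1').
rewrite -zz -ff in Ec2 hf1; rewrite -(res_form_fun hX0 hf0 hf1) in Ec2.
have := pencil_formP z hm hf0; rewrite -E1.
congr (res_form dot _ _ _).
by have E3 := sumE (csqr z); lra.
Qed.

Lemma pencil_arith_mean a b : 0 <= a <= 1 -> 0 <= b <= 1 ->
  arith_mean dot (res_rel (pencil a)) (res_rel (pencil b)) =
  res_rel (pencil (mean2 a b)).
Proof.
move=> ha hb; have hm := mean2_itv ha hb.
pose proof (nsa_res_rel (pencil_res hm)) as nm.
have two : 2^-1 = (2^-1)%:C :> R[i] by rewrite fmorphV rmorph_nat.
have p2 : 0 < 2 :> R by [].
(* The right side is written as half of its double; the double is the candidate for the form sum
   handed to [rel_of_formE]. *)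
rewrite /arith_mean two -[RHS](scale_relK _ p2); congr scale_rel.
apply: rel_of_formE; first exact: (scale_nsa p2 nm).
rewrite closed_formE; last exact: (scale_nsa p2 nm).
rewrite !closed_form_res; try exact: pencil_res.
apply/seteqP; split=> -[f z]; rewrite /rel_form_graph /form_add /=.
  move=> [c hc ->].
  have : rel_form dot (res_rel (pencil (mean2 a b))) f (2^-1 * c).
    by rewrite -(scale_relK (res_rel _) p2); apply: rel_form_scale; rewrite ?invr_gt0.
  move=> /(rel_form_res _ _ (pencil_res hm)) /(pencil_form_add _ _ ha hb).
  move=> [c1 [c2 [h1 h2 E]]]; exists c1%:C, c2%:C; split; [by exists c1|by exists c2|].
  by rewrite -rmorphD /= -E mulrA mulfV // mul1r.
move=> [_ [_ [[c1 h1 ->] [c2 h2 ->] ->]]]; exists (c1 + c2); last by rewrite rmorphD.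
have -> : c1 + c2 = 2 * ((c1 + c2) / 2) by field.
apply: rel_form_scale => //; apply/(rel_form_res _ _ (pencil_res hm)).
by apply/(pencil_form_add _ _ ha hb); exists c1, c2; split=> //; field.
Qed.

End Pencil.

(** * The iteration of means *)

Section ScalarIteration.
Context {R : realType}.
Implicit Types a b c d : R.

Definition ah_step (p : R * R) : R * R :=
  (mean2 p.1 p.2, 1 - mean2 (1 - p.1) (1 - p.2)).

Definition ah_invariant c (p : R * R) : Prop :=
  p.1 * p.2 * (1 - c) ^+ 2 = (1 - p.1) * (1 - p.2) * c ^+ 2.

(** A denominator vanishes only at a = b = 0 or a = b = 1, where division by 0 yields 0 and the step
    fixes the pair. *)
Lemma ah_step_degenerate a b : 0 <= a <= 1 -> 0 <= b <= 1 ->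
  ((a + b) * (2 - (a + b)) != 0) \/ (ah_step (a, b) = (a, b) /\ a = b).
Proof.
move=> /andP[a0 a1] /andP[b0 b1].
have [s0|s0] := eqVneq (a + b) 0.
  have -> : a = 0 by lra.
  have -> : b = 0 by lra.
  by right; rewrite /ah_step /mean2 /= !subr0 !mulr0 mul0r; split=> //; congr (_, _); field.
have [s2|s2] := eqVneq (a + b) 2.
  have -> : a = 1 by lra.
  have -> : b = 1 by lra.
  by right; rewrite /ah_step /mean2 /= !subrr !mulr0 mul0r subr0; split=> //;
    congr (_, _); field.
by left; rewrite mulf_neq0 // subr_eq0 eq_sym.
Qed.

Lemma ah_step_gap a b : (a + b) * (2 - (a + b)) != 0 ->
  (ah_step (a, b)).2 - (ah_step (a, b)).1 = (a - b) ^+ 2 / ((a + b) * (2 - (a + b))).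
Proof.
rewrite mulf_eq0 negb_or => /andP[s0 s2]; rewrite /ah_step /mean2 /=.
have -> : 1 - a + (1 - b) = 2 - (a + b) by ring.
by field; rewrite s2 s0.
Qed.

Lemma ah_step_itv a b : 0 <= a <= 1 -> 0 <= b <= 1 ->
  0 <= (ah_step (a, b)).1 <= 1 /\ 0 <= (ah_step (a, b)).2 <= 1.
Proof.
move=> ha hb; split; first exact: mean2_itv.
have ha' : 0 <= 1 - a <= 1 by lra.
have hb' : 0 <= 1 - b <= 1 by lra.
by have := mean2_itv ha' hb'; rewrite /ah_step /=; lra.
Qed.

Lemma ah_step_invariant a b c : 0 <= a <= 1 -> 0 <= b <= 1 ->
  ah_invariant c (a, b) -> ah_invariant c (ah_step (a, b)).
Proof.
move=> ha hb; have [|[-> _] //] := ah_step_degenerate ha hb.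
rewrite mulf_eq0 negb_or => /andP[s0 s2].
rewrite /ah_invariant /ah_step /mean2 /= => inv.
have -> : 1 - a + (1 - b) = 2 - (a + b) by ring.
(* One step multiplies both a b and (1 - a) (1 - b) by this k. *)
pose k := 2 * (a + b - 2 * a * b) / ((a + b) * (2 - (a + b))).
have -> : 2 * a * b / (a + b) * (1 - 2 * (1 - a) * (1 - b) / (2 - (a + b))) *
  (1 - c) ^+ 2 = k * (a * b * (1 - c) ^+ 2) by rewrite /k; field; rewrite s0 s2.
by rewrite inv /k; field; rewrite s0 s2.
Qed.

(* With s = a + b and x = |a - b| the gap becomes x^2 / (s (2 - s)), and
   s (2 - s) >= x (2 - x). *)
Lemma ah_step_contraction a b d : 0 <= a <= 1 -> 0 <= b <= 1 ->
  `|a - b| <= d -> d < 1 ->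
  0 <= (ah_step (a, b)).2 - (ah_step (a, b)).1 <= `|a - b| / (2 - d).
Proof.
move=> ha hb hd d1; have d2 : 0 < 2 - d by lra.
have [sn|[-> ->]] := ah_step_degenerate ha hb; last first.
  by rewrite /= !subrr normr0 mul0r lexx.
rewrite ah_step_gap //.
have s0 : 0 <= (a + b) * (2 - (a + b)) by rewrite mulr_ge0 //; lra.
rewrite divr_ge0 ?sqr_ge0 //= ler_pdivrMr ?lt0r ?sn // mulrAC ler_pdivlMr //.
rewrite -real_normK ?num_real //.
have h : `|a - b| * (2 - d) <= (a + b) * (2 - (a + b)).
  apply: (@le_trans _ _ (`|a - b| * (2 - `|a - b|))).
    by rewrite ler_wpM2l // lerD2l lerN2.
  have ba : 0 <= b * (1 - a) by rewrite mulr_ge0 //; lra.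
  have ab : 0 <= a * (1 - b) by rewrite mulr_ge0 //; lra.
  by case: (ger0P (a - b)) => _; nra.
by rewrite expr2 -mulrA ler_wpM2l.
Qed.

(** If c < a, then c^2 < a b while (1 - a) (1 - b) <= (1 - c)^2, against the invariant; the upper
    bound follows by x -> 1 - x. Thus the gap between the parameters bounds their distance to c. *)
Lemma ah_invariant_between a b c : 0 <= a -> a <= b -> b <= 1 -> 0 <= c <= 1 ->
  ah_invariant c (a, b) -> a <= c <= b.
Proof.
have lower (x y z : R) : 0 <= x -> x <= y -> y <= 1 -> 0 <= z <= 1 ->
    x * y * (1 - z) ^+ 2 = (1 - x) * (1 - y) * z ^+ 2 -> x <= z.
  move=> x0 xy y1 /andP[z0 z1] E; rewrite leNgt; apply/negP => zx.
  have h1 : z ^+ 2 < x * y by nra.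
  have h2 : (1 - x) * (1 - y) <= (1 - z) ^+ 2 by nra.
  have h3 : 0 < (1 - z) ^+ 2 by rewrite exprn_gt0 //; lra.
  have h4 : z ^+ 2 * (1 - z) ^+ 2 < x * y * (1 - z) ^+ 2 by rewrite ltr_pM2r.
  have h5 : (1 - x) * (1 - y) * z ^+ 2 <= (1 - z) ^+ 2 * z ^+ 2.
    by rewrite ler_wpM2r // sqr_ge0.
  by lra.
move=> a0 ab b1 hc; rewrite /ah_invariant /= => E; apply/andP; split.
  exact: (lower a b).
have E' : (1 - b) * (1 - a) * (1 - (1 - c)) ^+ 2 =
    (1 - (1 - b)) * (1 - (1 - a)) * (1 - c) ^+ 2.
  by rewrite !subKr (mulrC (1 - b)) (mulrC b) E.
have c1 : 0 <= 1 - c <= 1 by clear E E'; lra.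
have : 1 - b <= 1 - c.
  apply: (lower (1 - b) (1 - a) (1 - c) _ _ _ c1 E'); first by rewrite subr_ge0.
    by rewrite lerD2l lerN2.
  by rewrite gerBl.
by rewrite lerD2l lerN2.
Qed.

Lemma ah_iter_cvg a b c n : 0 <= a <= 1 -> 0 <= b <= 1 -> `|a - b| < 1 ->
  0 <= c <= 1 -> ah_invariant c (a, b) ->
  let p := iter n ah_step (a, b) in let q := (2 - `|a - b|)^-1 in
  [/\ 0 <= p.1 <= 1, 0 <= p.2 <= 1, `|p.1 - c| <= q ^+ n & `|p.2 - c| <= q ^+ n].
Proof.
move=> ha hb d1 hc inv p q.
have d0 := normr_ge0 (a - b).
have q0 : 0 < q by rewrite invr_gt0; lra.
have q1 : q <= 1 by rewrite invf_le1; lra.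
have far (x : R) : 0 <= x <= 1 -> `|x - c| <= 1.
  by move=> hx; rewrite ler_norml; lra.
(* The order p.1 <= p.2 is available only after one step; for n = 0 the bound is q^0 = 1, supplied
   by [far]. *)
suff : [/\ 0 <= p.1 <= 1, 0 <= p.2 <= 1, `|p.1 - p.2| <= q ^+ n * `|a - b|
    & ah_invariant c p /\ (n = 0%N \/ p.1 <= p.2)].
  move=> [h1 h2 h3 [h4 h5]]; split=> //.
    case: h5 => [->|le12]; first by rewrite expr0 far.
    have h4' : ah_invariant c (p.1, p.2) by rewrite -surjective_pairing.
    have /andP[b1 b2] : p.1 <= c <= p.2.
      by apply: (ah_invariant_between _ le12 _ hc h4'); lra.
    apply: le_trans (_ : q ^+ n * `|a - b| <= _); last by rewrite ler_piMr ?exprn_ge0 // ltW.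
    by apply: le_trans h3; rewrite !ler0_norm; lra.
  case: h5 => [->|le12]; first by rewrite expr0 far.
  have h4' : ah_invariant c (p.1, p.2) by rewrite -surjective_pairing.
  have /andP[b1 b2] : p.1 <= c <= p.2.
    by apply: (ah_invariant_between _ le12 _ hc h4'); lra.
  apply: le_trans (_ : q ^+ n * `|a - b| <= _); last by rewrite ler_piMr ?exprn_ge0 // ltW.
  by apply: le_trans h3; rewrite ger0_norm ?ler0_norm; lra.
rewrite {}/p; elim: n => [|n] /=.
  by rewrite expr0 mul1r; split=> //; split=> //; left.
move: (iter n ah_step (a, b)) => [x y] /= [hx hy hxy [hinv _]].
have [h1 h2] := ah_step_itv hx hy.
have hd : `|x - y| <= `|a - b|.
  by apply: le_trans hxy _; rewrite ler_piMl // exprn_ile1 // ltW.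
have /andP[g0 g1] := ah_step_contraction hx hy hd d1.
split=> //; last first.
  split; first exact: ah_step_invariant.
  by right; rewrite -subr_ge0.
rewrite distrC ger0_norm //; apply: le_trans g1 _.
by rewrite exprS -mulrA mulrC ler_wpM2l // ltW.
Qed.

Lemma ah_rate_cvg0 a b : `|a - b| < 1 ->
  (fun n => (2 - `|a - b|)^-1 ^+ n) @ \oo --> (0 : R).
Proof.
move=> d1; apply: cvg_expr; rewrite ger0_norm ?invr_ge0; last by lra.
by rewrite invf_lt1; lra.
Qed.

End ScalarIteration.

(** * Means and extensions along the pencil of resolvents *)

Section PencilMeans.
Context {R : realType} {H : completeNormedModType R[i]}.
Context {dot : {dot H for (@Num.conj R[i])}} {dot_norm : inner_norm dot}.
Local Notation rd := (rdot dot).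
Local Notation is_res := (is_resolvent dot).
Variables (X0 : H -> H) (e : H).
Local Notation pen := (pencil (dot := dot) X0 e).
Local Notation X0' := (fun x => x - pen 1 x).
Hypothesis hX0 : is_res X0.
Hypothesis hX1 : is_res (pen 1).
Hypothesis e_dom : forall c, ~ res_form dot X0 e c.
Hypothesis e_dom' : forall c, ~ res_form dot X0' e c.

(** Inversion turns the pencil from S_F to S_K into one of the same kind traversed backwards, with
    base I - X_1 and the same e. *)
Lemma pencil_compl t : (fun x => x - pen t x) = pencil (dot := dot) X0' e (1 - t).
Proof.
apply/funext => x; rewrite /pencil rmorphB !rmorph1 scalerBl !scale1r.
by rewrite !opprD !addrA subrK.
Qed.

Lemma pencil_harm_mean a b : 0 <= a <= 1 -> 0 <= b <= 1 ->
  harm_mean dot (res_rel (pen a)) (res_rel (pen b)) =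
  res_rel (pen (1 - mean2 (1 - a) (1 - b))).
Proof.
move=> ha hb; rewrite /harm_mean !inv_res_rel (pencil_compl a) (pencil_compl b).
have hX0' : is_res X0' := res_compl hX1.
have hX1' : is_res (pencil (dot := dot) X0' e 1).
  have := pencil_compl 0; rewrite subr0 => <-.
  by rewrite pencil0; exact: res_compl.
have := pencil_arith_mean hX0' hX1' e_dom' (a := 1 - a) (b := 1 - b).
rewrite /arith_mean => ->; [|lra|lra].
set m := mean2 _ _; have := pencil_compl (1 - m); rewrite subKr => <-.
by rewrite inv_res_rel; congr res_rel; apply/funext => x; rewrite subKr.
Qed.

Lemma pencil_ah a b c : 0 <= a <= 1 -> 0 <= b <= 1 -> `|a - b| < 1 ->
  0 <= c <= 1 -> ah_invariant c (a, b) ->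
  is_ah dot (res_rel (pen a)) (res_rel (pen b)) (res_rel (pen c), res_rel (pen c)).
Proof.
move=> ha hb d1 hc inv.
have it n := ah_iter_cvg n ha hb d1 hc inv.
have seqE n : ah_seq dot (res_rel (pen a)) (res_rel (pen b)) n =
    (res_rel (pen (iter n ah_step (a, b)).1), res_rel (pen (iter n ah_step (a, b)).2)).
  elim: n => // n IH; rewrite /ah_seq iterS -/(ah_seq _ _ _ n) IH /=.
  have [h1 h2 _ _] := it n.
  by rewrite (pencil_arith_mean hX0 hX1 e_dom h1 h2) (pencil_harm_mean h1 h2).
have lim (u : nat -> R) : (forall n, `|u n - c| <= (2 - `|a - b|)^-1 ^+ n) ->
    forall x, (fun n => pen (u n) x) @ \oo --> pen c x.
  move=> hu x; have := ah_rate_cvg0 d1 => /(cvgM (cvg_cst (rnorm (rank1 (dot := dot) e x)))).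
  rewrite mulr0; apply: cvgH_dominated => n.
  rewrite /pencil opprD addrACA subrr add0r -scalerBl -rmorphB /= rnormZ mulrC.
  by rewrite ler_wpM2l // rnorm_ge0.
have nc : nonneg_selfadjoint dot (res_rel (pen c)).
  by apply: nsa_res_rel; exact: (pencil_res hX0 hX1).
split; split=> // x /=.
- rewrite resolvent_res_rel (_ : (fun n => _) =
    (fun n => pen (iter n ah_step (a, b)).1 x)).
    by apply: (lim (fun n => (iter n ah_step (a, b)).1)) => n; have [] := it n.
  by apply/funext => n; rewrite seqE resolvent_res_rel.
- rewrite resolvent_res_rel (_ : (fun n => _) =
    (fun n => pen (iter n ah_step (a, b)).2 x)).
    by apply: (lim (fun n => (iter n ah_step (a, b)).2)) => n; have [] := it n.
  by apply/funext => n; rewrite seqE resolvent_res_rel.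
Qed.

(** D = X - X_0 lies between 0 and (., e) e. By Cauchy-Schwarz for D it vanishes on the orthogonal
    complement of e, and being symmetric it is a multiple of (., e) e. *)
Lemma pencil_squeeze X : is_res X -> (forall x, rd (X0 x) x <= rd (X x) x) ->
  (forall x, rd (X x) x <= rd (pen 1 x) x) -> exists2 t, 0 <= t <= 1 & X = pen t.
Proof.
move=> hX lo hi; pose D x := X x - X0 x.
have DL a x y : D (a *: x + y) = a *: D x + D y.
  by rewrite /D (res_lin hX) (res_lin hX0) opprD addrACA -scalerBr.
have Ds x y : rd (D x) y = rd x (D y).
  by rewrite /D !rdotE (res_sym hX) (res_sym hX0).
have D0 x : 0 <= rd (D x) x.
  by rewrite /D rdotDl rdotNl subr_ge0.
have D1 x : rd (D x) x <= rd (rank1 (dot := dot) e x) x.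
  by have := hi x; rewrite pencilE mul1r /D rdotDl rdotNl lerBlDl.
have Dker x : dot x e = 0 -> D x = 0.
  move=> xe; have Dx0 : rd (D x) x = 0.
    apply/eqP; rewrite eq_le D0 andbT; apply: le_trans (D1 x) _.
    by rewrite /rank1 xe scale0r rdot0l.
  apply: (@rdot_eqP _ _ dot) => y; rewrite rdot0l; apply/eqP.
  rewrite -sqrf_eq0 eq_le sqr_ge0 andbT; apply: le_trans (positive_CS x y DL Ds D0) _.
  by rewrite Dx0 mul0r.
have en : rd e e != 0.
  apply/negP => /eqP /(rdot_eq0 (dot := dot)) e0.
  pose proof (res_form_at 0 hX0) as h; rewrite {1}(res0 hX0) in h.
  by apply: (e_dom (c := rd (X0 0) 0 - rd (X0 0) (X0 0))); rewrite e0.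
have ee : dot e e = (rd e e)%:C by exact: dot_rnorm.
have een : dot e e != 0.
  by rewrite ee; apply/negP => /eqP /(@complexI _ _ 0) h; rewrite h eqxx in en.
pose pr x := x - (dot x e / dot e e) *: e.
have pr0 x : dot (pr x) e = 0.
  by rewrite /pr linearBl linearZl_LR /= divfK // subrr.
(* The residual r of D e is orthogonal to e, so D r = 0 and (r, r) = (D e, r) = (e, D r) = 0. *)
have De : D e = (dot (D e) e / dot e e) *: e.
  have u0 := Dker _ (pr0 (D e)).
  apply/eqP; rewrite -subr_eq0 -/(pr (D e)); apply/eqP/(rdot_eq0 (dot := dot)).
  rewrite {1}/pr rdotDl rdotNl Ds u0 rdot0r sub0r; apply/eqP; rewrite oppr_eq0.
  rewrite /rdot linearZl_LR /= (dot_conj (dot := dot) e (pr _)) pr0.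
  by rewrite conjc0 mulr0.
have Dx x : D x = (dot x e / dot e e) *: D e.
  have := Dker _ (pr0 x); rewrite /pr (linmapB DL) (linmapZ DL).
  by move=> /eqP; rewrite subr_eq0 => /eqP.
have eie : rd e ('i *: e) = 0.
  by have := rdotil (dot := dot) e e; rewrite rdotC => h; lra.
have DeR : dot (D e) e = (rd (D e) e)%:C.
  rewrite (dotE (dot := dot)); congr (_ +i* _).
  have Di : D ('i *: e) = 'i *: D e by rewrite (linmapZ DL).
  have h1 := Ds e ('i *: e); rewrite Di in h1.
  have h2 := rdotil (dot := dot) e (D e); rewrite (rdotC ('i *: e)) in h2.
  by lra.
(* Forced by (D e, e) = t |(e, e)|^2. *)
pose t := rd (D e) e / rd e e ^+ 2.
exists t.
  apply/andP; split; first by rewrite divr_ge0 // sqr_ge0.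
  rewrite ler_pdivrMr ?mul1r ?exprn_gt0 ?lt0r ?en ?rdot_ge0 //.
  apply: le_trans (D1 e) _.
  by rewrite rank1_form eie expr0n addr0.
apply/funext => x; rewrite /pencil -[LHS](subrK (X0 x)) -/(D x) addrC; congr (_ + _).
rewrite Dx De /rank1 !scalerA; congr (_ *: e).
by rewrite /t rmorphM /= fmorphV rmorphXn /= -ee -DeR; field.
Qed.

End PencilMeans.

(** * Extensions of S under the dimension-one hypothesis *)

Section OneDimensional.
Context {R : realType} {H : completeNormedModType R[i]}.
Context {dot : {dot H for (@Num.conj R[i])}} {dot_norm : inner_norm dot}.
Local Notation rd := (rdot dot).
Local Notation is_res := (is_resolvent dot).

(** If v spans the range and D y = v, then D x = a v with a (v, y) = (D x, y) = (x, v). Positivity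
    gives (v, y) > 0, and e is v divided by the square root of (v, y). *)
Lemma rank_one_positive (D : H -> H) :
  (forall a x y, D (a *: x + y) = a *: D x + D y) ->
  (forall x y, rd (D x) y = rd x (D y)) -> (forall x, 0 <= rd (D x) x) ->
  has_dim 1 (range D) ->
  exists2 e : H, e <> 0 & forall x, D x = dot x e *: e.
Proof.
move=> DL Ds D0 [v' [free rgD]]; pose v := v' ord0.
have Dv x : exists a, D x = a *: v.
  have : range D (D x) by exists x.
  by rewrite rgD => -[a _ <-]; exists (a ord0); rewrite big_ord1.
have [y Dy] : exists y, D y = v.
  have : range D v by rewrite rgD; exists (fun=> 1) => //; rewrite big_ord1 scale1r.
  by move=> [y _ Dy]; exists y.
have vn : v <> 0.
  move=> v0; have := free (fun=> 1); rewrite big_ord1 scale1r => /(_ v0 ord0) /eqP.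
  by rewrite oner_eq0.
clear rgD free.
have Ds' x z : dot (D x) z = dot x (D z).
  by rewrite !(dotE (dot := dot)) Ds Ds (linmapZ DL).
have kE : dot v y = (rd v y)%:C.
  have := dot_conj (dot := dot) (D y) y; rewrite -Ds' Dy /rdot.
  case: (dot v y) => u w /(congr1 (@complex.Im R)) /= hw; congr (_ +i* _); lra.
have k0 : 0 < rd v y.
  rewrite lt0r -{2}Dy D0 andbT; apply/eqP => k0; apply: vn; rewrite -Dy.
  apply: (@rdot_eqP _ _ dot) => z; rewrite rdot0l; apply/eqP.
  rewrite -sqrf_eq0 eq_le sqr_ge0 andbT; apply: le_trans (positive_CS y z DL Ds D0) _.
  by rewrite Dy k0 mul0r.
have kn : dot v y != 0.
  by rewrite kE; apply/negP => /eqP/(@complexI _ _ 0) h; rewrite h ltxx in k0.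
pose q := Num.sqrt (rd v y); have q0 : 0 < q by rewrite sqrtr_gt0.
have qq : q ^+ 2 = rd v y by rewrite sqr_sqrtr // ltW.
have qn : q%:C != 0.
  by apply/negP => /eqP/(@complexI _ _ 0) h; rewrite h ltxx in q0.
exists ((q^-1)%:C *: v).
  by move/eqP; rewrite scaler_eq0 => /orP[/eqP/(@complexI _ _ 0)/eqP|/eqP //];
    rewrite invr_eq0 gt_eqF.
move=> x; have [a Da] := Dv x.
have : dot (D x) y = dot x v by rewrite Ds' Dy.
rewrite Da linearZl_LR /= => ak.
rewrite linearZr /= scalerA; congr (_ *: v).
rewrite -ak kE -qq rmorphXn /= [_^-1%:C]fmorphV.
have -> : Num.conj (q%:C^-1) = q%:C^-1 by rewrite -fmorphV; exact: conjc_real.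
by field.
Qed.

(** Collects what the theorem uses about S, so that only the parameter t remains. [ep_dom1] is
    [ep_dom0] for the inverse relation, as the harmonic mean requires. *)
Record extension_pencil (S : set (H * H)) (X0 : H -> H) (e : H) : Prop := {
  ep_res0 : is_res X0;
  ep_res1 : is_res (pencil (dot := dot) X0 e 1);
  ep_neq0 : e <> 0;
  ep_dom0 : forall c, ~ res_form dot X0 e c;
  ep_dom1 : forall c,
    ~ res_form dot (fun x => x - pencil (dot := dot) X0 e 1 x) e c;
  ep_friedrichs : friedrichs dot S = res_rel X0;
  ep_krein : krein dot S = res_rel (pencil (dot := dot) X0 e 1);
  ep_extremal0 : extremal dot S (friedrichs dot S);
  ep_extremal1 : extremal dot S (krein dot S);
  ep_ext : forall T, nonneg_selfadjoint_ext dot S T ->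
    exists2 t, 0 <= t <= 1 & T = res_rel (pencil (dot := dot) X0 e t)
}.

Lemma extension_pencilP S T : linear_relation S -> symmetric_rel dot S ->
  nonneg_rel dot S -> nonneg_selfadjoint_ext dot S T ->
  has_dim 1 (range (fun x : H =>
     resolvent (krein dot S) x - resolvent (friedrichs dot S) x)) ->
  exists X0 e, extension_pencil S X0 e.
Proof.
move=> linS symS posS extT dimS.
have [X0 [hX0 FE SF formE]] := friedrichs_exists linS symS posS extT.
have [X1 [hX1 KE SK formE1]] := friedrichs_exists (inv_linear linS)
  (inv_symmetric symS) (inv_nonneg posS) (inv_ext extT).
have KE' : krein dot S = res_rel (fun x => x - X1 x) by rewrite /krein KE inv_res_rel.
move: dimS; rewrite KE' FE !resolvent_res_rel.
pose XK x := x - X1 x; have hXK : is_res XK := res_compl hX1.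
(* The closed form of S_F is the closure of that of S, so the form of any extension extends it;
   [le1] is the same bound for inverses. *)
have le0 X : is_res X -> S `<=` res_rel X -> forall x, rd (X0 x) x <= rd (X x) x.
  move=> hX SX; apply: res_form_mono => // f c /formE hf.
  by apply/(rel_form_res _ _ hX); exact: rel_form_sub hf.
have le1 X : is_res X -> S `<=` res_rel X -> forall x, rd (X x) x <= rd (XK x) x.
  move=> hX SX x; have hX' := res_compl hX.
  have : rd (X1 x) x <= rd (x - X x) x.
    apply: (res_form_mono hX1 hX') => f c /formE1 hf.
    apply/(rel_form_res _ _ hX'); apply: rel_form_sub hf => p Sp.
    by rewrite -inv_res_rel; exact: SX.
  by rewrite /XK !rdotDl !rdotNl; lra.
have SXK : S `<=` res_rel XK.
  by move=> p Sp; rewrite /XK -inv_res_rel; apply: SK; case: p Sp.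
move=> /(rank_one_positive (D := fun x => XK x - X0 x)) [a x y|x y|x|e en De].
- by rewrite /= (res_lin hXK) (res_lin hX0) opprD addrACA -scalerBr.
- by rewrite /= rdotDl rdotNl rdotDr rdotNr (res_sym hXK) (res_sym hX0).
- by rewrite /= rdotDl rdotNl subr_ge0 le0.
have XKE : XK = pencil (dot := dot) X0 e 1.
  by apply/funext => x; rewrite /pencil rmorph1 scale1r /rank1 -De addrC subrK.
have X1E : X1 = fun x => x - pencil (dot := dot) X0 e 1 x.
  by apply/funext => x; rewrite -XKE /XK subKr.
(* Both resolvents send p.1 + p.2 to p.1, so their difference (., e) e vanishes there. *)
have ort p : S p -> rd (p.1 + p.2) e = 0.
  move=> Sp; have := De (p.1 + p.2); rewrite (SXK _ Sp) (SF _ Sp) subrr => /esym/eqP.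
  by rewrite scaler_eq0 => /orP[/eqP h|/eqP //]; rewrite /rdot h.
have ex0 : extremal dot S (friedrichs dot S).
  by rewrite FE; exact: extremal_friedrichs.
have ex1 : extremal dot S (krein dot S).
  by apply: extremal_inv; rewrite /krein inv_relK KE; exact: extremal_friedrichs.
have dom0 c : ~ res_form dot X0 e c.
  by move=> /formE hf; apply: en; exact: orth_range_form hf.
exists X0, e; split=> //.
- by rewrite -XKE.
- rewrite -X1E => c /formE1 hf; apply: en; apply: orth_range_form hf.
  + exact: inv_linear.
  + exact: inv_symmetric.
  + exact: inv_nonneg.
  + by move=> p Sp; rewrite addrC; exact: (ort (p.2, p.1)).
- by rewrite -XKE.
- move=> T' [/nsaP [X hX ->] SX].
  have [t ht ->] : exists2 t, 0 <= t <= 1 & X = pencil (dot := dot) X0 e t.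
    by apply: pencil_squeeze; rewrite -?XKE //; [exact: le0 | exact: le1].
  by exists t.
Qed.

Lemma pencil_inj X0 e s t : e <> 0 ->
  res_rel (pencil (dot := dot) X0 e s) = res_rel (pencil (dot := dot) X0 e t) -> s = t.
Proof.
move=> en /res_relI /(congr1 (fun X => X e)); rewrite /pencil => /addrI /eqP.
rewrite -subr_eq0 -scalerBl scaler_eq0 -rmorphB => /orP[/eqP/(@complexI _ _ 0)|].
  by move=> h; apply/eqP; rewrite -subr_eq0 h.
rewrite /rank1 scaler_eq0 => /orP[/eqP h|/eqP //].
by case: en; apply: (rdot_eq0 (dot := dot)); rewrite /rdot h.
Qed.

Lemma resolvent_formulaP S X0 e t z : extension_pencil S X0 e ->
  resolvent_formula dot S (res_rel (pencil (dot := dot) X0 e t)) z <-> t = (1 + z) / 2.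
Proof.
move=> h; rewrite /resolvent_formula (ep_friedrichs h) (ep_krein h) !resolvent_res_rel.
have E x : 2^-1 *: (pencil (dot := dot) X0 e 1 x + X0 x) +
    (z / 2)%:C *: (pencil (dot := dot) X0 e 1 x - X0 x) =
    pencil (dot := dot) X0 e ((1 + z) / 2) x.
  have two : 2^-1 = (2^-1)%:C :> R[i] by rewrite fmorphV rmorph_nat.
  have half : 2^-1 + 2^-1 = 1 :> R by field.
  rewrite /pencil rmorph1 scale1r two; set r := rank1 _ _.
  have -> : X0 x + r - X0 x = r by rewrite addrAC subrr add0r.
  have -> : (2^-1)%:C *: (X0 x + r + X0 x) = X0 x + (2^-1)%:C *: r.
    by rewrite addrAC !scalerDr -scalerDl -rmorphD /= half rmorph1 scale1r.
  by rewrite -addrA -scalerDl -rmorphD /= [in RHS]mulrDl mul1r.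
split=> [f|-> x]; last by rewrite E.
apply: (@pencil_inj X0 e); first exact: (ep_neq0 h).
by congr res_rel; apply/funext => x; rewrite f E.
Qed.

End OneDimensional.

Theorem theorem7p4 (R : realType) (H : completeNormedModType R[i])
  (dot : {dot H for (@Num.conj R[i])})
  (dot_norm : forall x : H, dot x x = `|x| ^+ 2)
  (S : set (H * H))
  (linS : linear_relation S) (symS : symmetric_rel dot S)
  (posS : nonneg_rel dot S)
  (dimS : has_dim 1 (range (fun x : H =>
     resolvent (krein dot S) x - resolvent (friedrichs dot S) x))) :
  [/\ forall S1 S2 : set (H * H),
        nonneg_selfadjoint_ext dot S S1 -> nonneg_selfadjoint_ext dot S S2 ->
        ~ extremal dot S S1 -> ~ extremal dot S S2 -> S1 <> S2 ->
        exists L : set (H * H), is_ah dot S1 S2 (L, L) /\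
          forall z1 z2 : R, -1 <= z1 <= 1 -> -1 <= z2 <= 1 ->
            resolvent_formula dot S S1 z1 -> resolvent_formula dot S S2 z2 ->
            let p := Num.sqrt ((1 + z1) * (1 + z2)) in
            let m := Num.sqrt ((1 - z1) * (1 - z2)) in
            resolvent_formula dot S L ((p - m) / (p + m)),
      forall T : set (H * H), nonneg_selfadjoint_ext dot S T ->
        T <> krein dot S ->
        is_ah dot (friedrichs dot S) T (friedrichs dot S, friedrichs dot S)
    & forall T : set (H * H), nonneg_selfadjoint_ext dot S T ->
        T <> friedrichs dot S ->
        is_ah dot (krein dot S) T (krein dot S, krein dot S)].
Proof.
have dotN : inner_norm dot := dot_norm.
have Fp X0 e : extension_pencil (dot := dot) S X0 e ->
    friedrichs dot S = res_rel (pencil (dot := dot) X0 e 0).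
  by move=> h; rewrite pencil0 (ep_friedrichs h).
split=> [S1 S2 ext1 ext2 nex1 nex2 _|T extT nK|T extT nF].
- have [X0 [e h]] := extension_pencilP linS symS posS ext1 dimS.
  have [a /andP[a0 a1] E1] := ep_ext h ext1; have [b /andP[b0 b1] E2] := ep_ext h ext2.
  (* The end points t = 0 and t = 1 are S_F and S_K, which are extremal. *)
  have inner t : 0 <= t -> t <= 1 -> ~ extremal dot S (res_rel (pencil (dot := dot) X0 e t)) ->
      0 < t < 1.
    move=> t0 t1 nex; rewrite !lt_neqAle t0 t1 !andbT; apply/andP; split; apply/eqP => et.
      by apply: nex; rewrite -et -(Fp _ _ h); exact: (ep_extremal0 h).
    by apply: nex; rewrite et -(ep_krein h); exact: (ep_extremal1 h).
  have /andP[ap al] : 0 < a < 1 by apply: inner; rewrite -?E1.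
  have /andP[bp bl] : 0 < b < 1 by apply: inner; rewrite -?E2.
  pose P := Num.sqrt (a * b); pose M := Num.sqrt ((1 - a) * (1 - b)).
  have P0 : 0 < P by rewrite sqrtr_gt0 mulr_gt0.
  have M0 : 0 < M by rewrite sqrtr_gt0 mulr_gt0 // subr_gt0.
  have P2 : P ^+ 2 = a * b by rewrite sqr_sqrtr // mulr_ge0.
  have M2 : M ^+ 2 = (1 - a) * (1 - b) by rewrite sqr_sqrtr // mulr_ge0 // subr_ge0.
  have PMn : P + M != 0 by rewrite gt_eqF // addr_gt0.
  (* Solves c : (1 - c) = P : M, the positive square root of the invariant ratio. *)
  pose c := P / (P + M).
  have c1 : 1 - c = M / (P + M) by rewrite /c; field.
  exists (res_rel (pencil (dot := dot) X0 e c)); split.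
    rewrite E1 E2; apply: pencil_ah; rewrite ?a0 ?b0 //; try by case: h.
    + by rewrite ltr_norml; apply/andP; split; lra.
    + have PM0 : 0 < P + M by rewrite addr_gt0.
      apply/andP; split; first by apply: divr_ge0; exact: ltW.
      by rewrite ler_pdivrMr // mul1r lerDl ltW.
    + by rewrite /ah_invariant /= c1 /c !expr_div_n -P2 -M2 mulrCA.
  move=> z1 z2 _ _; rewrite E1 E2 => /(resolvent_formulaP _ _ h) az
    /(resolvent_formulaP _ _ h) bz p m.
  apply/(resolvent_formulaP _ _ h).
  have s2 : Num.sqrt 4 = 2 :> R by rewrite (_ : 4 = 2 ^+ 2) ?sqrtr_sqr ?ger0_norm //; ring.
  (* With 1 + z = 2 a and 1 - z = 2 (1 - a), the roots double, and (1 + (p - m) / (p + m)) / 2 = P /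
     (P + M). *)
  have pE : p = 2 * P.
    by rewrite /p /P -{1}s2 -sqrtrM ?ler0n //; congr Num.sqrt; rewrite az bz; field.
  have mE : m = 2 * M.
    by rewrite /m /M -{1}s2 -sqrtrM ?ler0n //; congr Num.sqrt; rewrite az bz; field.
  rewrite pE mE /c. field; rewrite PMn.
  by rewrite -mulrDr mulf_neq0.
- have [X0 [e h]] := extension_pencilP linS symS posS extT dimS.
  have [b /andP[b0 b1] E] := ep_ext h extT.
  have bn : b != 1 by apply/eqP => b1'; apply: nK; rewrite E b1' (ep_krein h).
  have bl : b < 1 by rewrite lt_neqAle bn.
  (* Parameters (0, b) with limit c = 0: both sides of the invariant vanish, and b < 1 gives the gap
     condition. *)
  rewrite (Fp _ _ h) E; apply: pencil_ah; rewrite ?b0 ?lexx ?ler01 //; try by case: h.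
    by rewrite sub0r normrN ger0_norm.
  by rewrite /ah_invariant /= mul0r mul0r expr0n mulr0.
- have [X0 [e h]] := extension_pencilP linS symS posS extT dimS.
  have [b /andP[b0 b1] E] := ep_ext h extT.
  have bn : b != 0 by apply/eqP => b0'; apply: nF; rewrite E b0' (Fp _ _ h).
  have bp : 0 < b by rewrite lt0r bn.
  rewrite (ep_krein h) E; apply: pencil_ah; rewrite ?b0 ?lexx ?ler01 //; try by case: h.
    by rewrite ger0_norm ?subr_ge0 // gtrBl.
  by rewrite /ah_invariant /= subrr !mul0r expr0n mulr0.
Qed.
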